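(* Let $f\colon\mathbb{D}\to\mathbb{D}$ be a parabolic holomorphic self-map with Wolff point $\tau_f\in\partial\mathbb{D}$ and positive hyperbolic step. Then all orbits of $f$ converge to $\tau_f$ tangentially. More precisely, there is a sign $\epsilon\in\{+1,-1\}$, the same for all $z\in\mathbb{D}$, such that $$\lim_{n\to+\infty}\frac{f^n(z)-\tau_f}{|f^n(z)-\tau_f|}=\epsilon\, i\,\tau_f\qquad\text{for all } z\in\mathbb{D}.$$
   Context: $\mathbb{D}=\{z\in\mathbb{C} : |z|<1\}$; $f^n$ is the $n$-th iterate of $f$, and the orbit of $z\in\mathbb{D}$ is the sequence $\{f^n(z)\}$. By the Wolff-Denjoy theorem, if a holomorphic $f\colon\mathbb{D}\to\mathbb{D}$ has no fixed points in $\mathbb{D}$, there is a point $\tau_f\in\partial\mathbb{D}$, called the Wolff point of $f$, such that $f^n\to\tau_f$ uniformly on compact subsets of $\mathbb{D}$; moreover $f'$ admits a non-tangential limit at $\tau_f$, denoted $f'(\tau_f)$, and $f'(\tau_f)\in(0,1]$. The map $f$ is called parabolic if it has no fixed points in $\mathbb{D}$ and $f'(\tau_f)=1$. The Poincaré distance on $\mathbb{D}$ is $\omega(z_1,z_2)=\tanh^{-1}\left|\frac{z_2-z_1}{1-\overline{z_1}z_2}\right|$, where $\tanh^{-1}t=\frac12\log\frac{1+t}{1-t}$. The hyperbolic step of $f$ is $s^f(z)=\lim_{n\to+\infty}\omega\bigl(f^n(z),f^{n+1}(z)\bigr)$ for $z\in\mathbb{D}$ (the limit exists because the sequence is non-increasing);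 $f$ has positive hyperbolic step if there exists $z_0\in\mathbb{D}$ with $s^f(z_0)>0$. *)

(* Defs.v *)
From Stdlib Require Import Reals List.
From Coquelicot Require Import Coquelicot.
Open Scope R_scope.

Definition unit_disc (z : C) : Prop := Cmod z < 1.

(* Maps of the disc are total functions [C -> C] of which only the values on
   [unit_disc] are ever used: [unit_disc] is open, so differentiability at its points and
   the iterates started in it do not depend on the values elsewhere. *)
Definition holomorphic_self_map (f : C -> C) : Prop :=
  forall z : C, unit_disc z ->
    unit_disc (f z) /\ @ex_derive C_AbsRing C_NormedModule f z.

Definition iterate (f : C -> C) (n : nat) (z : C) : C := Nat.iter n f z.

Definition compact_set (K : C -> Prop) : Prop :=
  forall (I : Type) (U : I -> C -> Prop),
    (forall i : I, open (U i)) ->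
    (forall z : C, K z -> exists i : I, U i z) ->
    exists l : list I, forall z : C, K z -> exists i : I, In i l /\ U i z.

Definition fixed_point_free (f : C -> C) : Prop :=
  forall z : C, unit_disc z -> f z <> z.

Definition wolff_point (f : C -> C) (tau : C) : Prop :=
  Cmod tau = 1 /\
  forall K : C -> Prop, compact_set K -> (forall z : C, K z -> unit_disc z) ->
    forall eps : R, 0 < eps ->
      exists N : nat, forall n : nat, (N <= n)%nat ->
        forall z : C, K z -> Cmod (iterate f n z - tau)%C < eps.

Definition stolz_region (tau : C) (M : R) (z : C) : Prop :=
  unit_disc z /\ Cmod (z - tau)%C < M * (1 - Cmod z).

Definition nontangential_limit (g : C -> C) (tau l : C) : Prop :=
  forall M : R, 1 < M ->
    filterlim g (within (stolz_region tau M) (locally tau)) (locally l).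

(* The Wolff point is unique, being the limit of every orbit, so the existential
   just names it. *)
Definition parabolic (f : C -> C) : Prop :=
  fixed_point_free f /\
  exists tau : C,
    wolff_point f tau /\ nontangential_limit (C_derive f) tau (RtoC 1).

Definition artanh (t : R) : R := / 2 * ln ((1 + t) / (1 - t)).

Definition poincare_dist (z1 z2 : C) : R :=
  artanh (Cmod ((z2 - z1) / (1 - Cconj z1 * z2))%C).

(* For a holomorphic self-map the sequence is non-increasing and nonnegative on
   the disc, so [Lim_seq] is its genuine, finite limit. *)
Definition hyperbolic_step (f : C -> C) (z : C) : R :=
  real (Lim_seq (fun n : nat => poincare_dist (iterate f n z) (iterate f (S n) z))).

Definition positive_hyperbolic_step (f : C -> C) : Prop :=
  exists z0 : C, unit_disc z0 /\ 0 < hyperbolic_step f z0.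

(* Tangential convergence: the sequence tends to [tau] and eventually leaves
   every Stolz region at [tau]. *)
Definition converges_tangentially (u : nat -> C) (tau : C) : Prop :=
  filterlim u eventually (locally tau) /\
  forall M : R, 1 < M -> eventually (fun n : nat => ~ stolz_region tau M (u n)).

(* Main.v *)
Require Import Defs.
From Stdlib Require Import Reals List Lra Lia Psatz Classical.
From Coquelicot Require Import Coquelicot.
Open Scope R_scope.

(** The orbits are shown to leave every Stolz region at [tau]; the direction of approach
    and its sign then follow from elementary plane geometry.

    Everything rests on the Schwarz-Pick lemma: [f] does not increase the pseudo-hyperbolic
    distance [pseudo_dist]. Hence the steps of an orbit decrease, a positive hyperbolic step
    at [z0] bounds all the steps of the orbit of [z0] from below, and any two orbits stay at
    bounded distance.

    Suppose that the orbit of [z0] returned infinitely often to a Stolz region. The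
    displacement [f w - w] has derivative [f' - 1], which tends to 0 in the region, and the
    region is convex, so the displacement varies by at most [e * Cmod (u - v)] between two
    of its points near [tau]. It tends to 0 along the returns, since the orbit converges to
    [tau]; therefore at a return [u] it is [o(Cmod (u - tau))], which in a Stolz region is
    [o(1 - Cmod u)], and the step at [u] tends to 0. This contradicts the lower bound on the
    steps ([recurrent_stolz_small_steps]). Since a bounded hyperbolic neighbourhood of a
    Stolz region lies in a larger Stolz region, every other orbit leaves all Stolz regions
    too ([orbit_leaves_stolz_regions]).

    A point [u] near [tau] and outside a large Stolz region sees [tau] almost along the
    tangent, so [(u - tau) / Cmod (u - tau)] is close to [Ci * tau] or to [- Ci * tau]
    ([direction_estimate]). Two such points on opposite sides are hyperbolically far apart
    ([not_opposite_sides]), so neither two consecutive points of an orbit nor corresponding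
    points of two orbits can be on opposite sides: the sign is eventually constant and is
    the same for all orbits.

    The Schwarz-Pick lemma is proved from complex differentiability alone. Goursat's
    bisection argument on rectangles, in logarithmic polar coordinates, shows that the
    average of a holomorphic function over the circle of radius [r] about 0 does not depend
    on [r]; so the value at 0 is bounded by the maximum over the circle
    ([Cmod_mean_value_inequality]). For [g] with a zero at [a], this bound is applied to
    [(w - a)] times a high power of [g / (w - a)], corrected to have modulus close to 1 near
    the unit circle ([schwarz_at_zero]). *)

(** * Circulation of a closed form around a rectangle *)

Definition circulation (P Q : R -> R -> R) (a b c d : R) : R :=
  RInt (fun s => P s c) a b - RInt (fun s => P s d) a b
  + (RInt (fun t => Q b t) c d - RInt (fun t => Q a t) c d).

(** The shared coefficient [Pt] says that [P ds + Q dt] is closed at the point. The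
    derivatives may be discontinuous in [s] and [t]: differentiability of a complex function
    at every point does not make its derivative continuous without a further argument. *)
Definition closed_form_at (P Q : R -> R -> R) (s t : R) : Prop :=
  exists Ps Pt Qt : R,
    differentiable_pt_lim P s t Ps Pt /\ differentiable_pt_lim Q s t Pt Qt.

Lemma differentiable_pt_lim_continuous_2d (P : R -> R -> R) (s t p q : R) :
  differentiable_pt_lim P s t p q -> continuity_2d_pt P s t.
Proof.
  intros H. apply differentiable_continuity_pt. exists p, q. exact H.
Qed.

Lemma ex_RInt_horizontal (P : R -> R -> R) (a b t : R) :
  (forall s, Rmin a b <= s <= Rmax a b -> continuity_2d_pt P s t) ->
  ex_RInt (fun s => P s t) a b.
Proof.
  intros H. apply (ex_RInt_continuous (V := R_CompleteNormedModule)).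
  intros s Hs. apply continuity_pt_filterlim. intros e He.
  destruct (H s Hs (mkposreal e He)) as [d Hd]. exists d. split.
  - apply cond_pos.
  - intros x [_ Hx]. unfold R_dist in *. simpl in *. unfold R_dist in *. apply Hd.
    + exact Hx.
    + rewrite Rminus_diag, Rabs_R0. apply cond_pos.
Qed.

Lemma ex_RInt_vertical (P : R -> R -> R) (c d s : R) :
  (forall t, Rmin c d <= t <= Rmax c d -> continuity_2d_pt P s t) ->
  ex_RInt (fun t => P s t) c d.
Proof.
  intros H. apply (ex_RInt_horizontal (fun x y => P y x)).
  intros t Ht e. destruct (H t Ht e) as [d' Hd]. exists d'.
  intros u v Hu Hv. apply Hd; assumption.
Qed.

Lemma RInt_near_constant (f : R -> R) (a b k e : R) :
  a <= b -> ex_RInt f a b -> (forall x, a <= x <= b -> Rabs (f x - k) <= e) ->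
  Rabs (RInt f a b - k * (b - a)) <= (b - a) * e.
Proof.
  intros Hab Hf He.
  replace (RInt f a b - k * (b - a)) with (RInt (fun x => f x - k) a b).
  - apply abs_RInt_le_const; try assumption.
    apply (ex_RInt_minus (V := R_NormedModule)); [assumption | apply ex_RInt_const].
  - rewrite (RInt_minus (V := R_CompleteNormedModule)); try assumption.
    + rewrite RInt_const. unfold minus, plus, opp, scal; simpl. unfold mult; simpl. ring.
    + apply ex_RInt_const.
Qed.

(** Quarters are named by their lower left corners. The comparison of reals decides which
    quarter still has too large a circulation, so the sequence of nested rectangles is an
    ordinary recursive function; the last quarter is the default. *)
Definition bad_quarter_corner (P Q : R -> R -> R) (bound w h : R) (p : R * R) : R * R :=
  let (x, y) := p in
  let bad x y := Rlt_dec bound (Rabs (circulation P Q x (x + w) y (y + h))) in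
  if bad x y then (x, y)
  else if bad (x + w) y then (x + w, y)
  else if bad x (y + h) then (x, y + h)
  else (x + w, y + h).

Fixpoint nested_corner (P Q : R -> R -> R) (e w h x y : R) (n : nat) : R * R :=
  match n with
  | O => (x, y)
  | S m => bad_quarter_corner P Q (e / 4 ^ S m) (w / 2 ^ S m) (h / 2 ^ S m)
             (nested_corner P Q e w h x y m)
  end.

Section Rectangle.

Variables (P Q : R -> R -> R) (a b c d : R).
Hypothesis Hab : a <= b.
Hypothesis Hcd : c <= d.
Hypothesis Hform :
  forall s t, a <= s <= b -> c <= t <= d -> closed_form_at P Q s t.

Lemma ex_RInt_P (s1 s2 t : R) :
  a <= s1 -> s1 <= s2 -> s2 <= b -> c <= t <= d -> ex_RInt (fun s => P s t) s1 s2.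
Proof.
  intros H1 H2 H3 H4. apply ex_RInt_horizontal. intros s Hs.
  rewrite Rmin_left, Rmax_right in Hs by lra.
  destruct (Hform s t) as (Ps & Pt & Qt & HP & HQ); try lra.
  eapply differentiable_pt_lim_continuous_2d; eassumption.
Qed.

Lemma ex_RInt_Q (s t1 t2 : R) :
  c <= t1 -> t1 <= t2 -> t2 <= d -> a <= s <= b -> ex_RInt (fun t => Q s t) t1 t2.
Proof.
  intros H1 H2 H3 H4. apply ex_RInt_vertical. intros t Ht.
  rewrite Rmin_left, Rmax_right in Ht by lra.
  destruct (Hform s t) as (Ps & Pt & Qt & HP & HQ); try lra.
  eapply differentiable_pt_lim_continuous_2d; eassumption.
Qed.

Lemma circulation_quarters (x y w h : R) :
  0 <= w -> 0 <= h -> a <= x -> x + 2 * w <= b -> c <= y -> y + 2 * h <= d ->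
  circulation P Q x (x + 2 * w) y (y + 2 * h) =
  circulation P Q x (x + w) y (y + h)
  + circulation P Q (x + w) (x + w + w) y (y + h)
  + circulation P Q x (x + w) (y + h) (y + h + h)
  + circulation P Q (x + w) (x + w + w) (y + h) (y + h + h).
Proof.
  intros Hw Hh H1 H2 H3 H4. unfold circulation.
  replace (x + w + w) with (x + 2 * w) by ring.
  replace (y + h + h) with (y + 2 * h) by ring.
  assert (EP : forall t, c <= t <= d -> RInt (fun s => P s t) x (x + 2 * w) =
     RInt (fun s => P s t) x (x + w) + RInt (fun s => P s t) (x + w) (x + 2 * w)).
  { intros t Ht. symmetry.
    apply (RInt_Chasles (V := R_CompleteNormedModule)); apply ex_RInt_P; lra. }
  assert (EQ : forall s, a <= s <= b -> RInt (fun t => Q s t) y (y + 2 * h) =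
     RInt (fun t => Q s t) y (y + h) + RInt (fun t => Q s t) (y + h) (y + 2 * h)).
  { intros s Hs. symmetry.
    apply (RInt_Chasles (V := R_CompleteNormedModule)); apply ex_RInt_Q; lra. }
  rewrite !EP, !EQ by lra. ring.
Qed.

(** To first order at [(p, q)] the two differences of the form along opposite sides are
    [- Pt * h] and [Pt * w], whose contributions to the circulation cancel; only the
    remainders of the two linear approximations are left. *)
Lemma circulation_local (p q : R) :
  a <= p <= b -> c <= q <= d -> forall e, 0 < e -> exists r, 0 < r /\
  forall x y w h, 0 <= w -> 0 <= h -> w < r -> h < r ->
    a <= x <= p -> p <= x + w <= b -> c <= y <= q -> q <= y + h <= d ->
    Rabs (circulation P Q x (x + w) y (y + h)) <= e * (w + h) ^ 2.
Proof.
  intros Hp Hq e He.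
  destruct (Hform p q Hp Hq) as (Ps & Pt & Qt & HP & HQ).
  assert (He2 : 0 < e / 2) by lra.
  destruct (HP (mkposreal _ He2)) as [r1 Hr1].
  destruct (HQ (mkposreal _ He2)) as [r2 Hr2].
  exists (Rmin r1 r2). split.
  { apply Rmin_glb_lt; apply cond_pos. }
  intros x y w h Hw Hh Hwr Hhr Hx Hxw Hy Hyh.
  assert (Hm1 := Rmin_l r1 r2). assert (Hm2 := Rmin_r r1 r2).
  assert (Hmax : forall s t, x <= s <= x + w -> y <= t <= y + h ->
     Rabs (s - p) < Rmin r1 r2 /\ Rabs (t - q) < Rmin r1 r2 /\
     e / 2 * Rmax (Rabs (s - p)) (Rabs (t - q)) <= e / 2 * (w + h)).
  { intros s t Hs Ht.
    assert (Rabs (s - p) <= w) by (apply Rabs_le; lra).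
    assert (Rabs (t - q) <= h) by (apply Rabs_le; lra).
    repeat split; try lra. apply Rmult_le_compat_l; [lra|]. apply Rmax_lub; lra. }
  assert (EP : forall s t, x <= s <= x + w -> y <= t <= y + h ->
     Rabs (P s t - P p q - (Ps * (s - p) + Pt * (t - q))) <= e / 2 * (w + h)).
  { intros s t Hs Ht. destruct (Hmax s t Hs Ht) as (A1 & A2 & A3).
    eapply Rle_trans; [apply Hr1; lra | exact A3]. }
  assert (EQ : forall s t, x <= s <= x + w -> y <= t <= y + h ->
     Rabs (Q s t - Q p q - (Pt * (s - p) + Qt * (t - q))) <= e / 2 * (w + h)).
  { intros s t Hs Ht. destruct (Hmax s t Hs Ht) as (A1 & A2 & A3).
    eapply Rle_trans; [apply Hr2; lra | exact A3]. }
  unfold circulation.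
  rewrite <- (RInt_minus (V := R_CompleteNormedModule)) by (apply ex_RInt_P; lra).
  rewrite <- (RInt_minus (V := R_CompleteNormedModule)) by (apply ex_RInt_Q; lra).
  assert (I1 : Rabs (RInt (fun s => P s y - P s (y + h)) x (x + w)
                     - (- Pt * h) * (x + w - x)) <= (x + w - x) * (e * (w + h))).
  { apply RInt_near_constant; try lra.
    - apply (ex_RInt_minus (V := R_NormedModule)); apply ex_RInt_P; lra.
    - intros s Hs. unfold minus, plus, opp; simpl.
      assert (E1 := EP s y ltac:(lra) ltac:(lra)).
      assert (E2 := EP s (y + h) ltac:(lra) ltac:(lra)).
      apply Rabs_le_between in E1. apply Rabs_le_between in E2. apply Rabs_le. lra. }
  assert (I2 : Rabs (RInt (fun t => Q (x + w) t - Q x t) y (y + h)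
                     - (Pt * w) * (y + h - y)) <= (y + h - y) * (e * (w + h))).
  { apply RInt_near_constant; try lra.
    - apply (ex_RInt_minus (V := R_NormedModule)); apply ex_RInt_Q; lra.
    - intros t Ht. unfold minus, plus, opp; simpl.
      assert (E1 := EQ (x + w) t ltac:(lra) ltac:(lra)).
      assert (E2 := EQ x t ltac:(lra) ltac:(lra)).
      apply Rabs_le_between in E1. apply Rabs_le_between in E2. apply Rabs_le. lra. }
  apply Rabs_le_between in I1. apply Rabs_le_between in I2. apply Rabs_le.
  match goal with |- _ <= ?u + ?v <= _ =>
    change (u : R) with (RInt (fun s => P s y - P s (y + h)) x (x + w));
    change (v : R) with (RInt (fun t => Q (x + w) t - Q x t) y (y + h)) end.
  revert I1 I2.
  generalize (RInt (fun s => P s y - P s (y + h)) x (x + w)).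
  generalize (RInt (fun t => Q (x + w) t - Q x t) y (y + h)).
  intros v u I1 I2. lra.
Qed.

Lemma pow_half_small (k r : R) : 0 < r -> exists n : nat, k / 2 ^ n < r.
Proof.
  intros Hr.
  destruct (pow_lt_1_zero (/ 2) ltac:(rewrite Rabs_pos_eq; lra) (r / (Rabs k + 1))) as [n Hn].
  { apply Rdiv_lt_0_compat; [assumption|]. assert (H := Rabs_pos k). lra. }
  exists n. specialize (Hn n (le_n n)).
  assert (Hp : 0 < (/ 2) ^ n) by (apply pow_lt; lra).
  rewrite Rabs_pos_eq in Hn by lra.
  assert (H := Rabs_pos k). assert (H' := Rle_abs k).
  apply Rmult_lt_compat_r with (r := Rabs k + 1) in Hn; [|lra].
  unfold Rdiv in Hn. rewrite Rmult_assoc, Rinv_l, Rmult_1_r in Hn by lra.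
  unfold Rdiv. rewrite <- pow_inv. nra.
Qed.

(** Goursat's bisection argument. A circulation larger than [e] passes to one of the
    quarters as a circulation larger than [e / 4], and so on; the nested rectangles shrink
    to a point, where the circulation would be too large for [circulation_local]. *)
Lemma circulation_closed : circulation P Q a b c d = 0.
Proof.
  assert (Hsmall : forall e, 0 < e -> Rabs (circulation P Q a b c d) <= e).
  2: { destruct (Req_dec (circulation P Q a b c d) 0) as [E | E]; [exact E|].
       apply Rabs_pos_lt in E.
       assert (H := Hsmall (Rabs (circulation P Q a b c d) / 2) ltac:(lra)). lra. }
  intros e He. apply Rnot_lt_le. intros Hbad.
  set (w := b - a). set (h := d - c).
  set (z := nested_corner P Q e w h a c).
  assert (Hw : forall n, 0 <= w / 2 ^ n).
  { intros n. apply Rdiv_le_0_compat; [unfold w; lra | apply pow_lt; lra]. }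
  assert (Hh : forall n, 0 <= h / 2 ^ n).
  { intros n. apply Rdiv_le_0_compat; [unfold h; lra | apply pow_lt; lra]. }
  assert (Hhalf : forall k n, k / 2 ^ n = 2 * (k / 2 ^ S n)).
  { intros k n. simpl. field. apply pow_nonzero. lra. }
  assert (Inv : forall n,
     a <= fst (z n) /\ fst (z n) + w / 2 ^ n <= b /\
     c <= snd (z n) /\ snd (z n) + h / 2 ^ n <= d /\
     e / 4 ^ n < Rabs (circulation P Q (fst (z n)) (fst (z n) + w / 2 ^ n)
                         (snd (z n)) (snd (z n) + h / 2 ^ n))).
  { intros n. induction n as [|n IH].
    - simpl. replace (a + w / 1) with b by (unfold w; field).
      replace (c + h / 1) with d by (unfold h; field).
      replace (e / 1) with e by field. unfold w, h. lra.
    - change (z (S n)) with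
        (bad_quarter_corner P Q (e / 4 ^ S n) (w / 2 ^ S n) (h / 2 ^ S n) (z n)).
      destruct (z n) as [x y]. cbn [fst snd] in IH.
      specialize (Hw (S n)). specialize (Hh (S n)).
      rewrite (Hhalf w n), (Hhalf h n) in IH.
      assert (E4 : e / 4 ^ n = 4 * (e / 4 ^ S n)).
      { simpl. field. apply pow_nonzero. lra. }
      rewrite E4 in IH.
      revert Hw Hh IH. generalize (w / 2 ^ S n) (h / 2 ^ S n) (e / 4 ^ S n).
      intros w' h' e' Hw Hh (I1 & I2 & I3 & I4 & I5).
      rewrite circulation_quarters in I5 by assumption.
      unfold bad_quarter_corner.
      destruct (Rlt_dec e' (Rabs (circulation P Q x (x + w') y (y + h')))) as [A1|A1];
        [cbn [fst snd]; repeat split; lra|].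
      destruct (Rlt_dec e' (Rabs (circulation P Q (x + w') (x + w' + w') y (y + h')))) as [A2|A2];
        [cbn [fst snd]; repeat split; lra|].
      destruct (Rlt_dec e' (Rabs (circulation P Q x (x + w') (y + h') (y + h' + h')))) as [A3|A3];
        [cbn [fst snd]; repeat split; lra|].
      cbn [fst snd]; repeat split; try lra.
      apply Rnot_lt_le in A1. apply Rnot_lt_le in A2. apply Rnot_lt_le in A3.
      apply Rnot_le_lt. intros A4. apply Rlt_not_le in I5. apply I5.
      apply Rabs_le_between in A1. apply Rabs_le_between in A2.
      apply Rabs_le_between in A3. apply Rabs_le_between in A4.
      apply Rabs_le. lra. }
  assert (Mono : forall n k, fst (z n) <= fst (z (n + k)%nat) /\
     fst (z (n + k)%nat) + w / 2 ^ (n + k) <= fst (z n) + w / 2 ^ n /\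
     snd (z n) <= snd (z (n + k)%nat) /\
     snd (z (n + k)%nat) + h / 2 ^ (n + k) <= snd (z n) + h / 2 ^ n).
  { intros n k. induction k as [|k IH].
    - rewrite Nat.add_0_r. lra.
    - rewrite Nat.add_succ_r.
      change (z (S (n + k))) with
        (bad_quarter_corner P Q (e / 4 ^ S (n + k)) (w / 2 ^ S (n + k)) (h / 2 ^ S (n + k))
           (z (n + k)%nat)).
      rewrite (Hhalf w (n + k)%nat), (Hhalf h (n + k)%nat) in IH.
      assert (Hw' := Hw (S (n + k))). assert (Hh' := Hh (S (n + k))).
      destruct (z (n + k)%nat) as [x y].
      unfold bad_quarter_corner. cbn [fst snd] in IH.
      repeat match goal with |- context [Rlt_dec ?u ?v] => destruct (Rlt_dec u v) end;
      cbn [fst snd]; lra. }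
  (* Nested intervals: the least upper bound of the left ends lies in all of them. *)
  assert (Lim : forall (u : nat -> R) (k : R), (forall n, 0 <= k / 2 ^ n) ->
     (forall n m, u n <= u (n + m)%nat /\ u (n + m)%nat + k / 2 ^ (n + m) <= u n + k / 2 ^ n) ->
     exists p, forall n, u n <= p <= u n + k / 2 ^ n).
  { intros u k Hk Hu.
    assert (Hcross : forall n m, u m <= u n + k / 2 ^ n).
    { intros n m. destruct (Hu n m) as [_ B1].
      destruct (Hu m n) as [B2 _]. rewrite (Nat.add_comm m n) in B2.
      specialize (Hk (n + m)%nat). lra. }
    destruct (completeness (fun x => exists n, x = u n)) as [p [Hp1 Hp2]].
    - exists (u O + k / 2 ^ 0). intros x [m ->]. apply Hcross.
    - exists (u O). exists O. reflexivity.
    - exists p. intros n. split.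
      + apply Hp1. exists n. reflexivity.
      + apply Hp2. intros x [m ->]. apply Hcross. }
  destruct (Lim (fun n => fst (z n)) w Hw) as [p Hp].
  { intros n m. destruct (Mono n m) as (B1 & B2 & _ & _). split; assumption. }
  destruct (Lim (fun n => snd (z n)) h Hh) as [q Hq].
  { intros n m. destruct (Mono n m) as (_ & _ & B1 & B2). split; assumption. }
  assert (Hp0 := Hp O). assert (Hq0 := Hq O). simpl in Hp0, Hq0.
  replace (a + w / 1) with b in Hp0 by (unfold w; field).
  replace (c + h / 1) with d in Hq0 by (unfold h; field).
  (* The added 1 covers a degenerate rectangle, for which [w + h = 0]. *)
  assert (Hd : 0 < (w + h) ^ 2 + 1) by (assert (Z := pow2_ge_0 (w + h)); lra).
  destruct (circulation_local p q Hp0 Hq0 (e / ((w + h) ^ 2 + 1))) as (r & Hr & Hloc).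
  { apply Rdiv_lt_0_compat; assumption. }
  destruct (pow_half_small (w + h) r Hr) as [n Hn].
  destruct (Inv n) as (B1 & B2 & B3 & B4 & B5).
  assert (Ewh : (w + h) / 2 ^ n = w / 2 ^ n + h / 2 ^ n) by (field; apply pow_nonzero; lra).
  specialize (Hw n). specialize (Hh n). specialize (Hp n). specialize (Hq n).
  assert (B6 := Hloc (fst (z n)) (snd (z n)) (w / 2 ^ n) (h / 2 ^ n)
    ltac:(lra) ltac:(lra) ltac:(lra) ltac:(lra) ltac:(lra) ltac:(lra) ltac:(lra) ltac:(lra)).
  rewrite <- Ewh in B6.
  assert (Hlt : e / ((w + h) ^ 2 + 1) * ((w + h) / 2 ^ n) ^ 2 <= e / 4 ^ n).
  { replace (4 ^ n) with (2 ^ n * 2 ^ n) by (rewrite <- Rpow_mult_distr; f_equal; ring).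
    replace (e / ((w + h) ^ 2 + 1) * ((w + h) / 2 ^ n) ^ 2)
      with (e / (2 ^ n * 2 ^ n) * ((w + h) ^ 2 / ((w + h) ^ 2 + 1))).
    - rewrite <- (Rmult_1_r (e / (2 ^ n * 2 ^ n))) at 2.
      apply Rmult_le_compat_l.
      + apply Rdiv_le_0_compat; [lra|]. apply Rmult_lt_0_compat; apply pow_lt; lra.
      + apply Rmult_le_reg_r with ((w + h) ^ 2 + 1); [assumption|].
        unfold Rdiv. rewrite Rmult_assoc, Rinv_l; lra.
    - field. split; [apply pow_nonzero; lra | lra]. }
  lra.
Qed.

End Rectangle.

(** * Calculus of complex differentiable functions *)

Definition linear_approx (f : C -> C) (z l : C) : Prop :=
  forall e, 0 < e -> exists d, 0 < d /\ forall w, Cmod (w - z) < d ->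
    Cmod (f w - f z - l * (w - z)) <= e * Cmod (w - z).

Lemma is_derive_linear_approx (f : C -> C) (z l : C) :
  @is_derive C_AbsRing C_NormedModule f z l <-> linear_approx f z l.
Proof.
  assert (Etr : forall w, minus (minus (f w) (f z)) (scal (minus w z) l) = (f w - f z - l * (w - z))%C).
  { intros w. unfold minus, plus, opp, scal; simpl. unfold mult; simpl. ring. }
  split.
  - intros [_ H] e He.
    destruct (H z (fun P HP => HP) (mkposreal e He)) as [d Hd].
    exists d. split; [apply cond_pos|]. intros w Hw.
    specialize (Hd w Hw). simpl in Hd. rewrite Etr in Hd. exact Hd.
  - intros H. split.
    + apply is_linear_scal_l.
    + intros x Hx.
      assert (E : z = x).
      { apply (is_filter_lim_locally_unique (K := C_AbsRing) (V := AbsRing_NormedModule C_AbsRing)). exact Hx. }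
      subst x. intros e. destruct (H e (cond_pos e)) as (d & Hd & H').
      exists (mkposreal d Hd). intros w Hw. rewrite Etr. exact (H' w Hw).
Qed.

Lemma Cmod_pair_Rmax (x y : R) : Cmod (x, y) <= 2 * Rmax (Rabs x) (Rabs y).
Proof.
  replace ((x, y) : C) with (RtoC x + Ci * RtoC y)%C.
  - eapply Rle_trans; [apply Cmod_triangle|].
    rewrite Cmod_mult, Cmod_Ci, !Cmod_R.
    assert (H1 := Rmax_l (Rabs x) (Rabs y)). assert (H2 := Rmax_r (Rabs x) (Rabs y)). lra.
  - unfold Cplus, Cmult, Ci, RtoC; simpl. f_equal; ring.
Qed.

Lemma im_le_Cmod (z : C) : Rabs (Im z) <= Cmod z.
Proof.
  eapply Rle_trans; [apply Rmax_r | apply (Rmax_Cmod z)].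
Qed.

(** The Cauchy-Riemann equations are the coincidence of coefficients in the conclusion. *)
Lemma differentiable_Re_Im (f : C -> C) (x y : R) (l : C) :
  linear_approx f (x, y) l ->
  differentiable_pt_lim (fun u v => Re (f (u, v))) x y (Re l) (- Im l) /\
  differentiable_pt_lim (fun u v => Im (f (u, v))) x y (Im l) (Re l).
Proof.
  intros H.
  assert (Key : forall e : posreal, exists d : posreal, forall u v,
     Rabs (u - x) < d -> Rabs (v - y) < d ->
     Cmod (f (u, v) - f (x, y) - l * ((u, v) - (x, y))) <= e * Rmax (Rabs (u - x)) (Rabs (v - y))).
  { intros e. assert (He : 0 < e / 2) by (assert (E := cond_pos e); lra).
    destruct (H (e / 2) He) as (d & Hd & H').
    assert (Hd2 : 0 < d / 2) by lra.
    exists (mkposreal _ Hd2). simpl. intros u v Hu Hv.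
    assert (B : Cmod ((u, v) - (x, y))%C <= 2 * Rmax (Rabs (u - x)) (Rabs (v - y))).
    { replace ((u, v) - (x, y))%C with ((u - x, v - y) : C) by reflexivity.
      apply Cmod_pair_Rmax. }
    assert (B' : Rmax (Rabs (u - x)) (Rabs (v - y)) < d / 2) by (apply Rmax_lub_lt; assumption).
    eapply Rle_trans; [apply H'; lra|]. nra. }
  split; intros e; destruct (Key e) as [d Hd]; exists d; intros u v Hu Hv;
    specialize (Hd u v Hu Hv); refine (Rle_trans _ _ _ _ Hd).
  - eapply Rle_trans; [| apply re_le_Cmod].
    apply Req_le. f_equal. unfold Re, Im. simpl. ring.
  - eapply Rle_trans; [| apply im_le_Cmod].
    apply Req_le. f_equal. unfold Re, Im. simpl. ring.
Qed.

Lemma differentiable_pt_lim_mult (x y : R) :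
  differentiable_pt_lim (fun u v => u * v) x y y x.
Proof.
  intros e. exists e. intros u v Hu Hv.
  replace (u * v - x * y - (y * (u - x) + x * (v - y))) with ((u - x) * (v - y)) by ring.
  rewrite Rabs_mult.
  apply Rmult_le_compat; try apply Rabs_pos; [lra | apply Rmax_r].
Qed.

Lemma differentiable_pt_lim_separated (g h : R -> R) (s t g' h' : R) :
  derivable_pt_lim g s g' -> derivable_pt_lim h t h' ->
  differentiable_pt_lim (fun u v => g u * h v) s t (g' * h t) (g s * h').
Proof.
  intros Hg Hh.
  replace (g' * h t) with (h t * g' + g s * 0) by ring.
  replace (g s * h') with (h t * 0 + g s * h') by ring.
  apply (differentiable_pt_lim_comp (fun u v => u * v) (fun u _ => g u) (fun _ v => h v)).
  - apply differentiable_pt_lim_mult.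
  - apply differentiable_pt_lim_proj1_0. exact Hg.
  - intros e. destruct (Hh e (cond_pos e)) as [d Hd]. exists d. intros u v _ Hv.
    destruct (Req_dec (v - t) 0) as [E | E].
    + replace v with t by lra.
      replace (h t - h t - (0 * (u - s) + h' * (t - t))) with 0 by ring.
      rewrite Rabs_R0. apply Rmult_le_pos; [apply Rlt_le, cond_pos|].
      eapply Rle_trans; [apply Rabs_pos | apply Rmax_l].
    + specialize (Hd (v - t) E Hv). replace (t + (v - t)) with v in Hd by ring.
      replace (h v - h t - (0 * (u - s) + h' * (v - t)))
        with (((h v - h t) / (v - t) - h') * (v - t)) by (field; exact E).
      rewrite Rabs_mult. apply Rmult_le_compat; try apply Rabs_pos; [lra | apply Rmax_r].
Qed.

(** [C] carries two uniform structures, from the product [R * R] and from the modulus. They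
    have the same neighbourhoods but are not convertible; continuity is fixed here with
    respect to the modulus. *)
Definition C_continuous (f : C -> C) (z : C) : Prop :=
  @continuous (AbsRing_UniformSpace C_AbsRing) (AbsRing_UniformSpace C_AbsRing) f z.

Definition C_near (z : C) (P : C -> Prop) : Prop :=
  @locally (AbsRing_UniformSpace C_AbsRing) z P.

(** Caratheodory's form of differentiability: the difference quotient extends continuously
    to the point. It reduces every differentiation rule to a continuity rule, and it shows
    at once that [(w - a) * P w] is differentiable at [a] as soon as [P] is continuous there,
    which takes the place of a removable singularity theorem in the Schwarz lemma. *)
Definition C_differentiable (f : C -> C) (z : C) : Prop :=
  exists phi : C -> C, C_continuous phi z /\
    C_near z (fun w => f w - f z = phi w * (w - z))%C.

Lemma C_near_intro (z : C) (P : C -> Prop) (d : R) :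
  0 < d -> (forall w, Cmod (w - z) < d -> P w) -> C_near z P.
Proof.
  intros Hd H. exists (mkposreal d Hd). intros w Hw. apply H. exact Hw.
Qed.

Lemma C_near_elim (z : C) (P : C -> Prop) :
  C_near z P -> exists d, 0 < d /\ forall w, Cmod (w - z) < d -> P w.
Proof.
  intros [d H]. exists d. split; [apply cond_pos | exact H].
Qed.

Lemma C_continuous_near (f : C -> C) (z : C) (e : R) :
  C_continuous f z -> 0 < e -> C_near z (fun w => Cmod (f w - f z) < e).
Proof.
  intros H He. exact (proj1 (filterlim_locally _ _) H (mkposreal e He)).
Qed.

Lemma C_continuous_intro (f : C -> C) (z : C) :
  (forall e, 0 < e -> C_near z (fun w => Cmod (f w - f z) < e)) -> C_continuous f z.
Proof.
  intros H. apply filterlim_locally. intros e. exact (H e (cond_pos e)).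
Qed.

Lemma C_continuous_const (c z : C) : C_continuous (fun _ => c) z.
Proof.
  exact (@continuous_const (AbsRing_UniformSpace C_AbsRing) (AbsRing_UniformSpace C_AbsRing) c z).
Qed.

Lemma C_continuous_id (z : C) : C_continuous (fun w => w) z.
Proof. exact (@continuous_id (AbsRing_UniformSpace C_AbsRing) z). Qed.

Lemma C_continuous_plus (f g : C -> C) (z : C) :
  C_continuous f z -> C_continuous g z -> C_continuous (fun w => f w + g w)%C z.
Proof.
  intros Hf Hg.
  exact (@continuous_plus (AbsRing_UniformSpace C_AbsRing) C_AbsRing
           (AbsRing_NormedModule C_AbsRing) f g z Hf Hg).
Qed.

Lemma C_continuous_mult (f g : C -> C) (z : C) :
  C_continuous f z -> C_continuous g z -> C_continuous (fun w => f w * g w)%C z.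
Proof.
  intros Hf Hg. exact (@continuous_mult (AbsRing_UniformSpace C_AbsRing) C_AbsRing f g z Hf Hg).
Qed.

Lemma C_continuous_pow (f : C -> C) (n : nat) (z : C) :
  C_continuous f z -> C_continuous (fun w => f w ^ n)%C z.
Proof.
  intros Hf. induction n as [|n IH]; simpl.
  - apply C_continuous_const.
  - apply C_continuous_mult; assumption.
Qed.

Lemma C_continuous_comp (f g : C -> C) (z : C) :
  C_continuous f z -> C_continuous g (f z) -> C_continuous (fun w => g (f w)) z.
Proof.
  intros Hf Hg.
  exact (@continuous_comp (AbsRing_UniformSpace C_AbsRing) (AbsRing_UniformSpace C_AbsRing)
           (AbsRing_UniformSpace C_AbsRing) f g z Hf Hg).
Qed.

Lemma C_continuous_neq_0 (f : C -> C) (z : C) :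
  C_continuous f z -> f z <> RtoC 0 -> C_near z (fun w => f w <> RtoC 0).
Proof.
  intros Hf H0. apply Cmod_gt_0 in H0.
  apply (filter_imp (F := locally _)) with (2 := C_continuous_near f z _ Hf H0).
  intros w Hw E. rewrite E in Hw.
  replace (RtoC 0 - f z)%C with (- f z)%C in Hw by ring. rewrite Cmod_opp in Hw. lra.
Qed.

Lemma C_continuous_inv (f : C -> C) (z : C) :
  C_continuous f z -> f z <> RtoC 0 -> C_continuous (fun w => / f w)%C z.
Proof.
  intros Hf H0. assert (H0' := proj1 (Cmod_gt_0 _) H0).
  apply C_continuous_intro. intros e He.
  assert (Hm : 0 < Rmin (Cmod (f z) / 2) (e * Cmod (f z) * Cmod (f z) / 2)).
  { apply Rmin_glb_lt; [lra|]. apply Rdiv_lt_0_compat; [|lra].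
    repeat apply Rmult_lt_0_compat; assumption. }
  apply (filter_imp (F := locally _)) with
    (2 := filter_and _ _ (C_continuous_near f z _ Hf Hm) (C_continuous_neq_0 f z Hf H0)).
  intros w [Hw Hw0].
  assert (H1 := Rmin_l (Cmod (f z) / 2) (e * Cmod (f z) * Cmod (f z) / 2)).
  assert (H2 := Rmin_r (Cmod (f z) / 2) (e * Cmod (f z) * Cmod (f z) / 2)).
  assert (Hlow : Cmod (f z) / 2 < Cmod (f w)).
  { assert (T := Cmod_triangle (f w) (- (f w - f z))%C). rewrite Cmod_opp in T.
    replace (f w + - (f w - f z))%C with (f z) in T by ring. lra. }
  replace (/ f w - / f z)%C with (- (f w - f z) * / (f w * f z))%C by (field; split; assumption).
  assert (Hp : (f w * f z)%C <> RtoC 0) by (apply Cmult_neq_0; assumption).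
  rewrite Cmod_mult, Cmod_opp, Cmod_inv, Cmod_mult by exact Hp.
  apply Rmult_lt_reg_r with (Cmod (f w) * Cmod (f z)).
  - apply Rmult_lt_0_compat; lra.
  - rewrite Rmult_assoc, Rinv_l by (apply Rgt_not_eq, Rmult_lt_0_compat; lra).
    assert (e * Cmod (f z) * (Cmod (f z) / 2) < e * Cmod (f z) * Cmod (f w)).
    { apply Rmult_lt_compat_l; [apply Rmult_lt_0_compat|]; assumption. }
    lra.
Qed.

Lemma ex_derive_slope (f : C -> C) (a : C) :
  @ex_derive C_AbsRing C_NormedModule f a ->
  exists phi, C_continuous phi a /\ forall w, (f w - f a = phi w * (w - a))%C.
Proof.
  intros [l Hl]. apply is_derive_linear_approx in Hl.
  exists (fun w => if Ceq_dec w a then l else ((f w - f a) / (w - a))%C). split.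
  - apply C_continuous_intro. intros e He.
    destruct (Hl (e / 2) ltac:(lra)) as (d & Hd & H).
    apply C_near_intro with d; [exact Hd|]. intros w Hw.
    destruct (Ceq_dec a a) as [_ | N]; [| contradiction].
    destruct (Ceq_dec w a) as [-> | N].
    + replace (l - l)%C with (RtoC 0) by ring. rewrite Cmod_0. exact He.
    + assert (Hn : (w - a)%C <> RtoC 0).
      { intros E. apply N. replace w with (w - a + a)%C by ring. rewrite E. ring. }
      replace ((f w - f a) / (w - a) - l)%C with ((f w - f a - l * (w - a)) / (w - a))%C
        by (field; exact Hn).
      rewrite Cmod_div by exact Hn. apply Cmod_gt_0 in Hn.
      apply Rmult_lt_reg_r with (Cmod (w - a)%C); [exact Hn|].
      unfold Rdiv at 1. rewrite Rmult_assoc, Rinv_l, Rmult_1_r by lra.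
      eapply Rle_lt_trans; [apply H; exact Hw|]. apply Rmult_lt_compat_r; lra.
  - intros w. destruct (Ceq_dec w a) as [-> | N]; [ring|].
    field. intros E. apply N. replace w with (w - a + a)%C by ring. rewrite E. ring.
Qed.

Lemma C_differentiable_ex_derive (f : C -> C) (a : C) :
  C_differentiable f a <-> @ex_derive C_AbsRing C_NormedModule f a.
Proof.
  split.
  - intros (phi & Hc & Heq). exists (phi a). apply is_derive_linear_approx.
    intros e He.
    destruct (C_near_elim _ _ (filter_and _ _ Heq (C_continuous_near phi a e Hc He)))
      as (d & Hd & H).
    exists d. split; [exact Hd|]. intros w Hw. destruct (H w Hw) as [E B].
    rewrite E. replace (phi w * (w - a) - phi a * (w - a))%C with ((phi w - phi a) * (w - a))%C by ring.
    rewrite Cmod_mult. apply Rmult_le_compat_r; [apply Cmod_ge_0 | lra].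
  - intros H. destruct (ex_derive_slope f a H) as (phi & Hc & Heq).
    exists phi. split; [exact Hc|]. apply filter_forall. exact Heq.
Qed.

Lemma C_differentiable_continuous (f : C -> C) (z : C) :
  C_differentiable f z -> C_continuous f z.
Proof.
  intros (phi & Hc & Heq).
  apply (@continuous_ext_loc (AbsRing_UniformSpace C_AbsRing) (AbsRing_UniformSpace C_AbsRing)
           f (fun w => (f z + phi w * (w + - z))%C) z).
  - apply (filter_imp (F := locally _)) with (2 := Heq). intros w E.
    change ((f z + phi w * (w - z))%C = f w). rewrite <- E. ring.
  - apply C_continuous_plus; [apply C_continuous_const|].
    apply C_continuous_mult; [exact Hc|].
    apply C_continuous_plus; [apply C_continuous_id | apply C_continuous_const].
Qed.

Lemma C_differentiable_const (c z : C) : C_differentiable (fun _ => c) z.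
Proof.
  exists (fun _ => RtoC 0). split; [apply C_continuous_const|].
  apply filter_forall. intros w. ring.
Qed.

Lemma C_differentiable_id (z : C) : C_differentiable (fun w => w) z.
Proof.
  exists (fun _ => RtoC 1). split; [apply C_continuous_const|].
  apply filter_forall. intros w. ring.
Qed.

Lemma C_differentiable_plus (f g : C -> C) (z : C) :
  C_differentiable f z -> C_differentiable g z -> C_differentiable (fun w => f w + g w)%C z.
Proof.
  intros (p & Hp & Ep) (q & Hq & Eq).
  exists (fun w => p w + q w)%C. split; [apply C_continuous_plus; assumption|].
  apply (filter_imp (F := locally _)) with (2 := filter_and _ _ Ep Eq).
  intros w [E1 E2].
  replace (f w + g w - (f z + g z))%C with ((f w - f z) + (g w - g z))%C by ring.
  rewrite E1, E2. ring.
Qed.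

Lemma C_differentiable_mult (f g : C -> C) (z : C) :
  C_differentiable f z -> C_differentiable g z -> C_differentiable (fun w => f w * g w)%C z.
Proof.
  intros Hf Hg. assert (Cg := C_differentiable_continuous g z Hg).
  destruct Hf as (p & Hp & Ep). destruct Hg as (q & Hq & Eq).
  exists (fun w => p w * g w + f z * q w)%C. split.
  - apply C_continuous_plus; apply C_continuous_mult; auto using C_continuous_const.
  - apply (filter_imp (F := locally _)) with (2 := filter_and _ _ Ep Eq).
    intros w [E1 E2].
    replace (f w * g w - f z * g z)%C with ((f w - f z) * g w + f z * (g w - g z))%C by ring.
    rewrite E1, E2. ring.
Qed.

Lemma C_differentiable_minus_const (c z : C) : C_differentiable (fun w => w - c)%C z.
Proof.
  apply (C_differentiable_plus (fun w => w) (fun _ => - c)%C);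
    [apply C_differentiable_id | apply C_differentiable_const].
Qed.

Lemma C_differentiable_one_minus (c z : C) : C_differentiable (fun w => 1 - c * w)%C z.
Proof.
  apply (C_differentiable_plus (fun _ => RtoC 1) (fun w => - (c * w))%C);
    [apply C_differentiable_const|].
  exists (fun _ => - c)%C. split; [apply C_continuous_const|].
  apply filter_forall. intros w. ring.
Qed.

Lemma C_differentiable_pow (f : C -> C) (n : nat) (z : C) :
  C_differentiable f z -> C_differentiable (fun w => f w ^ n)%C z.
Proof.
  intros Hf. induction n as [|n IH]; simpl.
  - apply C_differentiable_const.
  - apply C_differentiable_mult; assumption.
Qed.

Lemma C_differentiable_inv (f : C -> C) (z : C) :
  C_differentiable f z -> f z <> RtoC 0 -> C_differentiable (fun w => / f w)%C z.
Proof.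
  intros Hf H0. assert (Cf := C_differentiable_continuous f z Hf).
  destruct Hf as (p & Hp & Ep).
  exists (fun w => - / f z * (p w * / f w))%C. split.
  - apply C_continuous_mult; [apply C_continuous_const|].
    apply C_continuous_mult; [exact Hp | apply C_continuous_inv; assumption].
  - apply (filter_imp (F := locally _)) with
      (2 := filter_and _ _ Ep (C_continuous_neq_0 f z Cf H0)).
    intros w [E1 E2].
    replace (/ f w - / f z)%C with (- / f z * ((f w - f z) * / f w))%C by (field; split; assumption).
    rewrite E1. ring.
Qed.

Lemma C_differentiable_comp (f g : C -> C) (z : C) :
  C_differentiable f z -> C_differentiable g (f z) -> C_differentiable (fun w => g (f w)) z.
Proof.
  intros Hf (q & Hq & Eq). assert (Cf := C_differentiable_continuous f z Hf).
  destruct Hf as (p & Hp & Ep).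
  exists (fun w => q (f w) * p w)%C. split.
  - apply C_continuous_mult; [apply C_continuous_comp; assumption | exact Hp].
  - apply (filter_imp (F := locally _)) with (2 := filter_and _ _ Ep (Cf _ Eq)).
    intros w [E1 E2]. rewrite E2, E1. ring.
Qed.

Lemma C_differentiable_ext_near (f g : C -> C) (z : C) :
  C_near z (fun w => f w = g w) -> C_differentiable f z -> C_differentiable g z.
Proof.
  intros H (p & Hp & Ep). assert (H0 := locally_singleton _ _ H). simpl in H0.
  exists p. split; [exact Hp|].
  apply (filter_imp (F := locally _)) with (2 := filter_and _ _ H Ep).
  intros w [E1 E2]. rewrite <- E1, <- H0. exact E2.
Qed.

(** * The mean value inequality *)

(** The complex exponential of [s + i t]. *)
Definition polar (s t : R) : C := (exp s * cos t, exp s * sin t).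

Lemma Cmod_polar (s t : R) : Cmod (polar s t) = exp s.
Proof.
  unfold Cmod, polar. simpl.
  replace (exp s * cos t * (exp s * cos t * 1) + exp s * sin t * (exp s * sin t * 1))
    with ((exp s)²).
  - apply sqrt_Rsqr. left. apply exp_pos.
  - assert (E := sin2_cos2 t). unfold Rsqr in *.
    replace (exp s * exp s) with (exp s * exp s * (sin t * sin t + cos t * cos t)); [ring|].
    rewrite E. ring.
Qed.

Lemma closed_form_polar (f : C -> C) (s t : R) :
  @ex_derive C_AbsRing C_NormedModule f (polar s t) ->
  closed_form_at (fun s t => Im (f (polar s t))) (fun s t => Re (f (polar s t))) s t.
Proof.
  intros [l Hl]. apply is_derive_linear_approx in Hl.
  destruct (differentiable_Re_Im f _ _ l Hl) as [HRe HIm].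
  assert (Hx := differentiable_pt_lim_separated exp cos s t _ _
                  (derivable_pt_lim_exp s) (derivable_pt_lim_cos t)).
  assert (Hy := differentiable_pt_lim_separated exp sin s t _ _
                  (derivable_pt_lim_exp s) (derivable_pt_lim_sin t)).
  assert (HP := differentiable_pt_lim_comp _ _ _ _ _ _ _ _ _ _ _ HIm Hx Hy).
  assert (HQ := differentiable_pt_lim_comp _ _ _ _ _ _ _ _ _ _ _ HRe Hx Hy).
  do 3 eexists. split; [exact HP|].
  eapply eq_ind_r with (P := fun k => differentiable_pt_lim _ s t k _); [exact HQ|]. ring.
Qed.

(** In logarithmic polar coordinates the horizontal sides of the rectangle with angles [0]
    and [2 * PI] carry the same values, so [circulation_closed] says that the integral of
    [Re f] over the circle of radius [exp s] does not depend on [s]. As [s] tends to minus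
    infinity it tends to [2 * PI * Re (f 0)]. *)
Lemma Re_mean_value_inequality (f : C -> C) (r M : R) :
  (forall z, unit_disc z -> @ex_derive C_AbsRing C_NormedModule f z) ->
  0 < r < 1 -> (forall z, Cmod z = r -> Re (f z) <= M) -> Re (f (RtoC 0)) <= M.
Proof.
  intros Hf Hr HM.
  assert (Hdisc : forall s t, s <= ln r -> unit_disc (polar s t)).
  { intros s t Hs. unfold unit_disc. rewrite Cmod_polar.
    apply Rle_lt_trans with (exp (ln r)); [| rewrite exp_ln; lra].
    destruct Hs as [Hs | ->]; [left; apply exp_increasing; exact Hs | right; reflexivity]. }
  set (Q := fun s t => Re (f (polar s t))). set (P := fun s t => Im (f (polar s t))).
  assert (HPI := PI_RGT_0).
  assert (Hex : forall s, s <= ln r -> ex_RInt (fun t => Q s t) 0 (2 * PI)).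
  { intros s Hs. apply (ex_RInt_Q P Q s s 0 (2 * PI)); try lra.
    intros s' t Hs' Ht. apply closed_form_polar, Hf, Hdisc. lra. }
  assert (Hconst : forall s, s <= ln r -> RInt (Q s) 0 (2 * PI) = RInt (Q (ln r)) 0 (2 * PI)).
  { intros s Hs.
    assert (E := circulation_closed P Q s (ln r) 0 (2 * PI) Hs ltac:(lra)
      ltac:(intros s' t Hs' Ht; apply closed_form_polar, Hf, Hdisc; lra)).
    unfold circulation in E.
    rewrite (RInt_ext (fun s => P s (2 * PI)) (fun s => P s 0)) in E.
    - change (fun t => Q s t) with (Q s) in E. change (fun t => Q (ln r) t) with (Q (ln r)) in E. lra.
    - intros x _. unfold P, polar. rewrite cos_2PI, sin_2PI, cos_0, sin_0. reflexivity. }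
  assert (Hup : RInt (Q (ln r)) 0 (2 * PI) <= 2 * PI * M).
  { replace (2 * PI * M) with (RInt (fun _ => M) 0 (2 * PI))
      by (rewrite RInt_const; unfold scal; simpl; unfold mult; simpl; ring).
    apply RInt_le; try lra.
    - apply Hex. lra.
    - apply ex_RInt_const.
    - intros t _. apply HM. rewrite Cmod_polar. apply exp_ln. lra. }
  apply Rnot_lt_le. intros Hlt.
  set (e := (Re (f (RtoC 0)) - M) / 2).
  assert (He : 0 < e) by (unfold e; lra).
  destruct (Hf (RtoC 0)) as [l Hl].
  { unfold unit_disc. rewrite Cmod_0. lra. }
  apply is_derive_linear_approx in Hl.
  destruct (Hl 1 Rlt_0_1) as (d & Hd & Hld).
  assert (Hl0 := Cmod_ge_0 l).
  (* On the circle of radius [d'] the function is within [e] of its value at the centre. *)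
  set (d' := Rmin (d / 2) (Rmin r (e / (1 + Cmod l)))).
  assert (Hd' : 0 < d').
  { unfold d'. repeat apply Rmin_glb_lt; try lra. apply Rdiv_lt_0_compat; lra. }
  assert (D1 : d' <= d / 2) by apply Rmin_l.
  assert (D2 : d' <= r) by (eapply Rle_trans; [apply Rmin_r | apply Rmin_l]).
  assert (D3 : d' * (1 + Cmod l) <= e).
  { replace e with (e / (1 + Cmod l) * (1 + Cmod l)) by (field; lra).
    apply Rmult_le_compat_r; [lra|]. eapply Rle_trans; [apply Rmin_r | apply Rmin_r]. }
  assert (Hs : ln d' <= ln r).
  { destruct D2 as [D2 | ->]; [left; apply ln_increasing; assumption | right; reflexivity]. }
  assert (Hlow : 2 * PI * (M + e) <= RInt (Q (ln d')) 0 (2 * PI)).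
  { replace (2 * PI * (M + e)) with (RInt (fun _ => M + e) 0 (2 * PI))
      by (rewrite RInt_const; unfold scal; simpl; unfold mult; simpl; ring).
    apply RInt_le; try lra.
    - apply ex_RInt_const.
    - apply Hex. exact Hs.
    - intros t _. unfold Q. set (z := polar (ln d') t).
      assert (Ez : Cmod z = d') by (unfold z; rewrite Cmod_polar; apply exp_ln; exact Hd').
      assert (Ez' : Cmod (z - RtoC 0)%C = d').
      { replace (z - RtoC 0)%C with z by ring. exact Ez. }
      assert (B := Hld z ltac:(lra)). rewrite Ez' in B.
      assert (B2 : Cmod (f z - f (RtoC 0)) <= e).
      { replace (f z - f (RtoC 0))%C with (f z - f (RtoC 0) - l * (z - RtoC 0) + l * (z - RtoC 0))%C by ring.
        eapply Rle_trans; [apply Cmod_triangle|]. rewrite (Cmod_mult l), Ez'. lra. }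
      assert (B3 := Rle_trans _ _ _ (re_le_Cmod _) B2).
      apply Rabs_le_between in B3.
      replace (Re (f z - f (RtoC 0))%C) with (Re (f z) - Re (f (RtoC 0))) in B3 by reflexivity.
      unfold e in *. lra. }
  rewrite Hconst in Hlow by exact Hs. nra.
Qed.

Lemma Cmod_mean_value_inequality (f : C -> C) (r M : R) :
  (forall z, unit_disc z -> @ex_derive C_AbsRing C_NormedModule f z) ->
  0 < r < 1 -> (forall z, Cmod z = r -> Cmod (f z) <= M) -> Cmod (f (RtoC 0)) <= M.
Proof.
  (* Multiplication by [k] rotates the value at 0 onto the positive real axis. *)
  intros Hf Hr HM. set (k := Cconj (f (RtoC 0))).
  assert (H : Re (k * f (RtoC 0))%C <= Cmod (f (RtoC 0)) * M).
  { apply (Re_mean_value_inequality (fun z => (k * f z)%C) r); [| exact Hr |].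
    - intros z Hz. apply C_differentiable_ex_derive, C_differentiable_mult.
      + apply C_differentiable_const.
      + apply C_differentiable_ex_derive, Hf, Hz.
    - intros z Hz. eapply Rle_trans; [apply Rle_abs|].
      eapply Rle_trans; [apply re_le_Cmod|].
      rewrite Cmod_mult. unfold k. rewrite Cmod_conj.
      apply Rmult_le_compat_l; [apply Cmod_ge_0 | apply HM; exact Hz]. }
  assert (E : (k * f (RtoC 0))%C = RtoC (Cmod (f (RtoC 0)) ^ 2)).
  { unfold k. rewrite Cmult_comm. symmetry. apply Cmod2_conj. }
  rewrite E in H. simpl in H.
  destruct (Cmod_ge_0 (f (RtoC 0))) as [G | G].
  - apply Rmult_le_reg_l with (Cmod (f (RtoC 0))); [exact G|]. lra.
  - rewrite <- G. eapply Rle_trans; [apply Cmod_ge_0 | apply (HM (RtoC r))].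
    rewrite Cmod_R. apply Rabs_pos_eq. lra.
Qed.

(** * The Schwarz-Pick lemma *)

Lemma Cmod_minus_sym (u v : C) : Cmod (u - v)%C = Cmod (v - u)%C.
Proof. rewrite <- Cmod_opp. f_equal. ring. Qed.

Lemma Cminus_neq_0 (u v : C) : u <> v -> (u - v)%C <> RtoC 0.
Proof.
  intros N E. apply N. replace u with (u - v + v)%C by ring. rewrite E. ring.
Qed.

Lemma pow_growth_bound (k x c : R) :
  0 < k -> 0 <= x -> 1 <= c -> (forall n, k * x ^ S n <= c ^ n) -> x <= c.
Proof.
  intros Hk Hx Hc H. apply Rnot_lt_le. intros Hlt.
  assert (Hq : 1 < x / c).
  { apply Rmult_lt_reg_r with c; [lra|]. unfold Rdiv. rewrite Rmult_assoc, Rinv_l; lra. }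
  destruct (Pow_x_infinity (x / c) ltac:(rewrite Rabs_pos_eq; lra) (/ (k * x) + 1)) as [n Hn].
  specialize (Hn n (le_n n)).
  assert (Hp : 0 < (x / c) ^ n) by (apply pow_lt; lra).
  rewrite Rabs_pos_eq in Hn by lra.
  specialize (H n). simpl in H.
  assert (Hcn : 0 < c ^ n) by (apply pow_lt; lra).
  assert (Hkx : 0 < k * x) by (apply Rmult_lt_0_compat; lra).
  assert (E : x ^ n = (x / c) ^ n * c ^ n).
  { rewrite <- Rpow_mult_distr. f_equal. field. lra. }
  rewrite E in H.
  assert (H1 : k * x * (x / c) ^ n <= 1).
  { apply Rmult_le_reg_r with (c ^ n); [exact Hcn|]. lra. }
  assert (H2 : k * x * (/ (k * x) + 1) <= k * x * (x / c) ^ n).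
  { apply Rmult_le_compat_l; lra. }
  rewrite Rmult_plus_distr_l, Rinv_r in H2 by lra. lra.
Qed.

Section Schwarz.

Variables (g : C -> C) (a : C).
Hypothesis Hdiff : forall z, unit_disc z -> @ex_derive C_AbsRing C_NormedModule g z.
Hypothesis Hbound : forall z, unit_disc z -> Cmod (g z) <= 1.
Hypothesis Ha : unit_disc a.
Hypothesis Hga : g a = RtoC 0.

(** Away from [a] the function is [b * (g / b) ^ S n], where
    [b w = (w - a) / (1 - Cconj a * w)] is the Blaschke factor of [a]. The extra factor [w - a] makes it differentiable at
    [a] although [q], the quotient of [g] by [w - a], is only known to be continuous there. *)
Lemma blaschke_power_differentiable (q : C -> C) (n : nat) :
  C_continuous q a -> (forall w, g w = (q w * (w - a))%C) ->
  forall z, unit_disc z ->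
  C_differentiable (fun w => (w - a) * (q w ^ S n * (1 - Cconj a * w) ^ n))%C z.
Proof.
  intros Hq Eq z Hz.
  assert (Haff := C_differentiable_one_minus (Cconj a) z).
  assert (Hlin := C_differentiable_minus_const a z).
  destruct (Ceq_dec z a) as [-> | N].
  - exists (fun w => q w ^ S n * (1 - Cconj a * w) ^ n)%C. split.
    + apply C_continuous_mult; apply C_continuous_pow; [exact Hq|].
      apply C_differentiable_continuous. exact Haff.
    + apply filter_forall. intros w. ring.
  - apply C_differentiable_mult; [exact Hlin|].
    apply C_differentiable_mult; apply C_differentiable_pow; [|exact Haff].
    assert (N' := Cminus_neq_0 _ _ N).
    apply (C_differentiable_ext_near (fun w => g w * / (w - a))%C).
    + apply (filter_imp (F := locally _)) with
        (2 := C_continuous_neq_0 (fun w => w - a)%C z (C_differentiable_continuous _ _ Hlin) N').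
      intros w Hw. rewrite Eq. field. exact Hw.
    + apply C_differentiable_mult.
      * apply C_differentiable_ex_derive, Hdiff, Hz.
      * apply (C_differentiable_inv (fun w => w - a)%C); assumption.
Qed.

(** The maximum principle applied to [g / b], with [b] the Blaschke factor of [a], would
    give the bound. Here the mean value inequality is applied instead to the functions of
    [blaschke_power_differentiable]: on the circle of radius [r] they are at most [c ^ n]
    with [c] close to 1, while at the centre they equal [Cmod a * (Cmod (g 0) / Cmod a) ^ S n]
    in modulus. Letting [n] grow, then [r] tend to 1, removes the extra factor. *)
Lemma schwarz_at_zero : Cmod (g (RtoC 0)) <= Cmod a.
Proof.
  destruct (Ceq_dec a (RtoC 0)) as [E0 | Na].
  { rewrite E0 in Hga. rewrite Hga, Cmod_0. apply Cmod_ge_0. }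
  apply Cmod_gt_0 in Na. unfold unit_disc in Ha.
  destruct (ex_derive_slope g a (Hdiff a Ha)) as (q & Hq & Eq0).
  assert (Eq : forall w, g w = (q w * (w - a))%C).
  { intros w. rewrite <- Eq0, Hga. ring. }
  assert (Hq0 : Cmod (g (RtoC 0)) = Cmod (q (RtoC 0)) * Cmod a).
  { rewrite Eq, Cmod_mult. f_equal. rewrite Cmod_minus_sym. f_equal. ring. }
  assert (Hr : forall r, Cmod a < r < 1 ->
            Cmod (q (RtoC 0)) <= 1 + (1 - r ^ 2) / (r - Cmod a)).
  { intros r Hr.
    assert (Hr2 : r ^ 2 < 1) by nra.
    assert (Hc : 0 <= (1 - r ^ 2) / (r - Cmod a)) by (apply Rdiv_le_0_compat; lra).
    apply (pow_growth_bound (Cmod a)); [exact Na | apply Cmod_ge_0 | lra |].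
    intros n.
    assert (K := Cmod_mean_value_inequality
      (fun w => (w - a) * (q w ^ S n * (1 - Cconj a * w) ^ n))%C r
      ((1 + (1 - r ^ 2) / (r - Cmod a)) ^ n)
      (fun z Hz => proj1 (C_differentiable_ex_derive _ _)
                     (blaschke_power_differentiable q n Hq Eq z Hz))
      ltac:(lra)).
    cbv beta in K.
    rewrite !Cmod_mult, !Cmod_pow in K.
    replace (RtoC 0 - a)%C with (- a)%C in K by ring.
    replace (1 - Cconj a * RtoC 0)%C with (RtoC 1) in K by ring.
    rewrite Cmod_opp, Cmod_1, pow1, Rmult_1_r in K. apply K.
    intros z Hz. rewrite !Cmod_mult, !Cmod_pow.
    assert (Hza : r - Cmod a <= Cmod (z - a)%C).
    { assert (T := Cmod_triangle (z - a)%C a). replace (z - a + a)%C with z in T by ring. lra. }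
    assert (Hg := Hbound z ltac:(unfold unit_disc; lra)). rewrite Eq, Cmod_mult in Hg.
    assert (Hden : Cmod (1 - Cconj a * z)%C <= Cmod (z - a)%C * (1 + (1 - r ^ 2) / (r - Cmod a))).
    { apply Rle_trans with ((1 - r ^ 2) + r * Cmod (z - a)%C).
      - replace (1 - Cconj a * z)%C with (RtoC (1 - r ^ 2) + z * Cconj (z - a))%C.
        + eapply Rle_trans; [apply Cmod_triangle|].
          rewrite Cmod_mult, Cmod_conj, Cmod_R, Hz, Rabs_pos_eq; lra.
        + rewrite <- Hz, RtoC_minus, Cmod2_conj.
          unfold Cconj, Cminus, Cmult, Cplus, Copp, RtoC; simpl. f_equal; ring.
      - assert (H1 : (r - Cmod a) * ((1 - r ^ 2) / (r - Cmod a)) = 1 - r ^ 2) by (field; lra).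
        assert (H2 : (r - Cmod a) * ((1 - r ^ 2) / (r - Cmod a))
                     <= Cmod (z - a)%C * ((1 - r ^ 2) / (r - Cmod a)))
          by (apply Rmult_le_compat_r; assumption).
        assert (H3 := Cmod_ge_0 (z - a)%C). nra. }
    set (x := Cmod (q z)) in *. set (y := Cmod (z - a)%C) in *.
    set (c := 1 + (1 - r ^ 2) / (r - Cmod a)) in *.
    assert (Hx : 0 <= x) by apply Cmod_ge_0.
    assert (Hpow : Cmod (1 - Cconj a * z)%C ^ n <= (y * c) ^ n).
    { apply pow_incr. split; [apply Cmod_ge_0 | exact Hden]. }
    apply Rle_trans with ((x * y) ^ S n * c ^ n).
    - replace ((x * y) ^ S n * c ^ n) with (y * (x ^ S n * (y * c) ^ n)).
      + apply Rmult_le_compat_l; [lra|]. apply Rmult_le_compat_l; [|exact Hpow].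
        apply pow_le, Hx.
      + rewrite !Rpow_mult_distr. simpl. ring.
    - rewrite <- (Rmult_1_l (c ^ n)) at 2. apply Rmult_le_compat_r.
      + apply pow_le. unfold c. lra.
      + rewrite <- (pow1 (S n)). apply pow_incr. split; [|exact Hg].
        apply Rmult_le_pos; [exact Hx | lra]. }
  rewrite Hq0.
  assert (Hle : Cmod (q (RtoC 0)) <= 1).
  { apply Rnot_lt_le. intros Hlt.
    set (k := Cmod (q (RtoC 0)) - 1) in *.
    set (s := Rmin (1 / 2) (k / 8)).
    assert (S1 : s <= 1 / 2) by apply Rmin_l.
    assert (S2 : s <= k / 8) by apply Rmin_r.
    assert (S0 : 0 < s) by (unfold s; apply Rmin_glb_lt; unfold k; lra).
    set (r := 1 - s * (1 - Cmod a)).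
    assert (B := Hr r ltac:(unfold r; nra)).
    assert (Hra : (1 - Cmod a) / 2 <= r - Cmod a) by (unfold r; nra).
    assert (Hrr : 1 - r ^ 2 <= 2 * s * (1 - Cmod a)) by (assert (T := pow2_ge_0 (s * (1 - Cmod a))); unfold r; lra).
    assert (Q : (1 - r ^ 2) / (r - Cmod a) <= k / 2).
    { apply Rmult_le_reg_r with (r - Cmod a); [lra|].
      unfold Rdiv at 1. rewrite Rmult_assoc, Rinv_l by lra. nra. }
    unfold k in Q. lra. }
  assert (H0 := Cmod_ge_0 a). nra.
Qed.

End Schwarz.

Definition moebius (c z : C) : C := ((z - c) / (1 - Cconj c * z))%C.

(** The hyperbolic tangent of the Poincare distance. *)
Definition pseudo_dist (u v : C) : R := Cmod (moebius u v).

Lemma moebius_denominator (c z : C) :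
  unit_disc c -> unit_disc z -> (1 - Cconj c * z)%C <> RtoC 0.
Proof.
  unfold unit_disc. intros Hc Hz E.
  assert (E1 : (Cconj c * z)%C = RtoC 1).
  { replace (Cconj c * z)%C with (1 - (1 - Cconj c * z))%C by ring. rewrite E. ring. }
  assert (E2 : Cmod c * Cmod z = 1).
  { rewrite <- (Cmod_conj c), <- Cmod_mult, E1. apply Cmod_1. }
  assert (P1 := Cmod_ge_0 c). assert (P2 := Cmod_ge_0 z). nra.
Qed.

Lemma moebius_identity (c z : C) :
  Cmod (1 - Cconj c * z)%C ^ 2 - Cmod (z - c)%C ^ 2 = (1 - Cmod c ^ 2) * (1 - Cmod z ^ 2).
Proof.
  rewrite !Cmod2_alt. destruct c as [c1 c2], z as [z1 z2].
  unfold Re, Im, Cconj, Cminus, Cmult, Cplus, Copp, RtoC; simpl. ring.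
Qed.

Lemma pseudo_dist_mult (u v : C) :
  unit_disc u -> unit_disc v ->
  pseudo_dist u v * Cmod (1 - Cconj u * v)%C = Cmod (v - u)%C.
Proof.
  intros Hu Hv. assert (N := moebius_denominator u v Hu Hv).
  unfold pseudo_dist, moebius. rewrite Cmod_div by exact N.
  apply Cmod_gt_0 in N. field. lra.
Qed.

Lemma pseudo_dist_ge_0 (u v : C) : 0 <= pseudo_dist u v.
Proof. apply Cmod_ge_0. Qed.

Lemma pseudo_dist_lt_1 (u v : C) : unit_disc u -> unit_disc v -> pseudo_dist u v < 1.
Proof.
  intros Hu Hv. assert (E := pseudo_dist_mult u v Hu Hv).
  assert (I := moebius_identity u v).
  assert (N := proj1 (Cmod_gt_0 _) (moebius_denominator u v Hu Hv)).
  assert (P := pseudo_dist_ge_0 u v).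
  unfold unit_disc in *.
  assert (U := Cmod_ge_0 u). assert (V := Cmod_ge_0 v).
  assert (0 < (1 - Cmod u ^ 2) * (1 - Cmod v ^ 2)) by (apply Rmult_lt_0_compat; nra).
  apply Rnot_le_lt. intros H1.
  assert (Cmod (1 - Cconj u * v)%C <= Cmod (v - u)%C) by (rewrite <- E; nra).
  assert (Cmod (1 - Cconj u * v)%C ^ 2 <= Cmod (v - u)%C ^ 2) by (apply pow_incr; lra).
  lra.
Qed.

Lemma pseudo_dist_sym (u v : C) : pseudo_dist u v = pseudo_dist v u.
Proof.
  unfold pseudo_dist, moebius. destruct (Ceq_dec (1 - Cconj u * v)%C (RtoC 0)) as [E | N].
  - assert (E' : (1 - Cconj v * u)%C = RtoC 0).
    { apply Cmod_eq_0. rewrite <- Cmod_conj.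
      replace (Cconj (1 - Cconj v * u))%C with (1 - Cconj u * v)%C.
      - rewrite E. apply Cmod_0.
      - unfold Cconj, Cminus, Cmult, Cplus, Copp, RtoC; simpl. f_equal; ring. }
    rewrite E, E'. unfold Cdiv. rewrite !Cmod_mult, (Cmod_minus_sym u v). reflexivity.
  - assert (E' : (1 - Cconj v * u)%C = Cconj (1 - Cconj u * v)%C).
    { unfold Cconj, Cminus, Cmult, Cplus, Copp, RtoC; simpl. f_equal; ring. }
    assert (N' : (1 - Cconj v * u)%C <> RtoC 0).
    { apply Cmod_gt_0. rewrite E', Cmod_conj. apply Cmod_gt_0, N. }
    rewrite !Cmod_div by assumption. rewrite E', Cmod_conj, (Cmod_minus_sym u v). reflexivity.
Qed.

Lemma moebius_differentiable (c z : C) :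
  unit_disc c -> unit_disc z -> C_differentiable (moebius c) z.
Proof.
  intros Hc Hz. unfold moebius, Cdiv.
  apply (C_differentiable_mult (fun w => w - c)%C (fun w => / (1 - Cconj c * w))%C).
  - apply C_differentiable_minus_const.
  - apply (C_differentiable_inv (fun w => 1 - Cconj c * w)%C);
      [apply C_differentiable_one_minus|].
    apply moebius_denominator; assumption.
Qed.

Lemma unit_disc_opp (z : C) : unit_disc z -> unit_disc (- z)%C.
Proof. unfold unit_disc. rewrite Cmod_opp. auto. Qed.

Lemma moebius_inverse (c z : C) :
  unit_disc c -> unit_disc z -> moebius (- c)%C (moebius c z) = z.
Proof.
  intros Hc Hz. assert (N := moebius_denominator c z Hc Hz).
  assert (N' := moebius_denominator c c Hc Hc).
  unfold moebius. replace (Cconj (- c))%C with (- Cconj c)%C.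
  - field. split; [exact N|].
    intros E. apply N'. rewrite <- E. ring.
  - unfold Cconj, Copp; simpl. reflexivity.
Qed.

(** Moebius maps at the source and at the target turn the inequality into
    [schwarz_at_zero] with [a = moebius u v]: they move [u] to the centre and [f v] to 0. *)
Lemma schwarz_pick (f : C -> C) (u v : C) :
  holomorphic_self_map f -> unit_disc u -> unit_disc v ->
  pseudo_dist (f u) (f v) <= pseudo_dist u v.
Proof.
  intros Hf Hu Hv.
  destruct (Hf u Hu) as [Hfu _]. destruct (Hf v Hv) as [Hfv _].
  assert (Hu' := unit_disc_opp u Hu).
  set (g := fun w => moebius (f v) (f (moebius (- u)%C w))).
  assert (Hin : forall z, unit_disc z -> unit_disc (moebius (- u)%C z)).
  { intros z Hz. exact (pseudo_dist_lt_1 _ z Hu' Hz). }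
  assert (B : Cmod (g (RtoC 0)) <= Cmod (moebius u v)).
  { apply schwarz_at_zero.
    - intros z Hz. apply C_differentiable_ex_derive. unfold g.
      destruct (Hf _ (Hin z Hz)) as [F1 F2].
      apply (C_differentiable_comp (fun w => f (moebius (- u)%C w)) (moebius (f v))).
      + apply (C_differentiable_comp (moebius (- u)%C) f).
        * apply moebius_differentiable; assumption.
        * apply C_differentiable_ex_derive. exact F2.
      + apply moebius_differentiable; assumption.
    - intros z Hz. left. destruct (Hf _ (Hin z Hz)) as [F1 _].
      exact (pseudo_dist_lt_1 _ _ Hfv F1).
    - exact (pseudo_dist_lt_1 _ _ Hu Hv).
    - unfold g. rewrite moebius_inverse by assumption.
      unfold moebius. unfold Cdiv. replace (f v - f v)%C with (RtoC 0) by ring. ring. }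
  rewrite pseudo_dist_sym. unfold pseudo_dist.
  replace u with (moebius (- u)%C (RtoC 0)) at 1; [exact B|].
  unfold moebius. replace (1 - Cconj (- u) * RtoC 0)%C with (RtoC 1) by ring.
  field.
Qed.

(** * Steps of an orbit *)

Lemma iterate_unit_disc (f : C -> C) (n : nat) (z : C) :
  holomorphic_self_map f -> unit_disc z -> unit_disc (iterate f n z).
Proof.
  intros Hf Hz. induction n as [|n IH]; [exact Hz|]. exact (proj1 (Hf _ IH)).
Qed.

Lemma pseudo_dist_iterate (f : C -> C) (z w : C) (n : nat) :
  holomorphic_self_map f -> unit_disc z -> unit_disc w ->
  pseudo_dist (iterate f n z) (iterate f n w) <= pseudo_dist z w.
Proof.
  intros Hf Hz Hw. induction n as [|n IH]; [apply Rle_refl|].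
  eapply Rle_trans; [| exact IH].
  apply (schwarz_pick f); auto using iterate_unit_disc.
Qed.

Definition step (f : C -> C) (z : C) (n : nat) : R :=
  pseudo_dist (iterate f n z) (iterate f (S n) z).

Lemma step_decreasing (f : C -> C) (z : C) (n m : nat) :
  holomorphic_self_map f -> unit_disc z -> (n <= m)%nat -> step f z m <= step f z n.
Proof.
  intros Hf Hz Hnm. induction Hnm as [|m Hnm IH]; [apply Rle_refl|].
  eapply Rle_trans; [| exact IH].
  apply (schwarz_pick f); auto.
  - apply iterate_unit_disc; assumption.
  - apply (iterate_unit_disc f (S m)); assumption.
Qed.

Lemma artanh_bounds (t : R) : 0 <= t <= 1 / 2 -> 0 <= artanh t <= 2 * t.
Proof.
  intros Ht. unfold artanh.
  assert (E : (1 + t) / (1 - t) = 1 + 2 * t / (1 - t)) by (field; lra).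
  assert (Hq : 0 <= 2 * t / (1 - t)) by (apply Rdiv_le_0_compat; lra).
  assert (Hq2 : 2 * t / (1 - t) <= 4 * t).
  { apply Rmult_le_reg_r with (1 - t); [lra|].
    unfold Rdiv. rewrite Rmult_assoc, Rinv_l by lra. nra. }
  rewrite E. split.
  - assert (0 <= ln (1 + 2 * t / (1 - t))); [|lra].
    rewrite <- ln_1. destruct Hq as [Hq | <-].
    + left. apply ln_increasing; lra.
    + right. f_equal. ring.
  - assert (ln (1 + 2 * t / (1 - t)) <= 2 * t / (1 - t)); [|lra].
    rewrite <- (ln_exp (2 * t / (1 - t))) at 2.
    assert (H := exp_ineq1_le (2 * t / (1 - t))).
    destruct H as [H | H]; [left; apply ln_increasing; lra | right; f_equal; exact H].
Qed.

(** By monotonicity one small step forces all later ones to be small, hence a zero limit;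
    a positive limit therefore bounds the steps from below. *)
Lemma hyperbolic_step_pos (f : C -> C) (z : C) :
  holomorphic_self_map f -> unit_disc z -> 0 < hyperbolic_step f z ->
  exists d, 0 < d /\ forall n, d <= step f z n.
Proof.
  intros Hf Hz Hpos. apply NNPP. intros Hno.
  assert (Hsmall : forall d, 0 < d -> exists n, step f z n < d).
  { intros d Hd. apply NNPP. intros H. apply Hno. exists d. split; [exact Hd|].
    intros n. apply Rnot_lt_le. intros Hn. apply H. exists n. exact Hn. }
  assert (Hlim : is_lim_seq (fun n => poincare_dist (iterate f n z) (iterate f (S n) z)) 0).
  { apply is_lim_seq_spec. intros e.
    assert (He := cond_pos e).
    destruct (Hsmall (Rmin (1 / 2) (e / 2))) as [N HN].
    { apply Rmin_glb_lt; lra. }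
    assert (M1 := Rmin_l (1 / 2) (e / 2)). assert (M2 := Rmin_r (1 / 2) (e / 2)).
    exists N. intros n Hn.
    change (poincare_dist (iterate f n z) (iterate f (S n) z)) with (artanh (step f z n)).
    assert (D := step_decreasing f z N n Hf Hz Hn).
    assert (P : 0 <= step f z n) by apply pseudo_dist_ge_0.
    assert (B := artanh_bounds (step f z n) ltac:(lra)).
    rewrite Rminus_0_r, Rabs_pos_eq; lra. }
  unfold hyperbolic_step in Hpos.
  rewrite (is_lim_seq_unique _ _ Hlim) in Hpos. simpl in Hpos. lra.
Qed.

(** * Stolz regions *)

(** A bounded distance rewritten through [moebius_identity] so that no division remains. *)
Lemma pseudo_dist_cross (u v : C) (r : R) :
  unit_disc u -> unit_disc v -> pseudo_dist u v <= r ->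
  (1 - r ^ 2) * Cmod (1 - Cconj u * v)%C ^ 2 <= (1 - Cmod u ^ 2) * (1 - Cmod v ^ 2).
Proof.
  intros Hu Hv Hr. assert (E := pseudo_dist_mult u v Hu Hv).
  assert (I := moebius_identity u v). assert (P := pseudo_dist_ge_0 u v).
  rewrite <- I, <- E, Rpow_mult_distr.
  assert (pseudo_dist u v ^ 2 <= r ^ 2) by (apply pow_incr; lra).
  assert (H2 := pow2_ge_0 (Cmod (1 - Cconj u * v)%C)). nra.
Qed.

Lemma moebius_denominator_lower (u v : C) :
  unit_disc v -> 1 - Cmod u <= Cmod (1 - Cconj u * v)%C.
Proof.
  unfold unit_disc. intros Hv.
  assert (T := Cmod_triangle (1 - Cconj u * v)%C (Cconj u * v)%C).
  replace (1 - Cconj u * v + Cconj u * v)%C with (RtoC 1) in T by ring.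
  rewrite Cmod_1, Cmod_mult, Cmod_conj in T.
  assert (P := Cmod_ge_0 u). nra.
Qed.

(** A hyperbolic neighbourhood of bounded radius of a Stolz region lies in a larger Stolz
    region: with [k = 1 - r ^ 2], the distances of [u] and [v] to the unit circle are
    comparable up to the factor [4 / k], and [Cmod (v - u)] is at most
    [4 / k * (1 - Cmod v)]. *)
Lemma stolz_region_pseudo_dist (tau u v : C) (M r : R) :
  0 < M -> unit_disc v -> r < 1 -> pseudo_dist u v <= r ->
  stolz_region tau M u -> stolz_region tau (4 * (M + 1) / (1 - r ^ 2)) v.
Proof.
  intros HM Hv Hr Huv [Hu Hs]. split; [exact Hv|].
  assert (P := pseudo_dist_ge_0 u v).
  assert (X := pseudo_dist_cross u v r Hu Hv Huv).
  assert (L := moebius_denominator_lower u v Hv).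
  assert (E := pseudo_dist_mult u v Hu Hv).
  assert (T : Cmod (v - tau)%C <= Cmod (v - u)%C + Cmod (u - tau)%C).
  { replace (v - tau)%C with ((v - u) + (u - tau))%C by ring. apply Cmod_triangle. }
  assert (Pu := Cmod_ge_0 u). assert (Pv := Cmod_ge_0 v).
  unfold unit_disc in *.
  set (a := 1 - Cmod u) in *. set (b := 1 - Cmod v) in *.
  set (N := Cmod (1 - Cconj u * v)%C) in *. set (k := 1 - r ^ 2) in *.
  assert (Hk : 0 < k) by (unfold k; nra).
  assert (Ha : 0 < a <= 1) by (unfold a; lra). assert (Hb : 0 < b <= 1) by (unfold b; lra).
  assert (X2 : k * N ^ 2 <= 4 * a * b).
  { eapply Rle_trans; [exact X|].
    replace (1 - Cmod u ^ 2) with (a * (2 - a)) by (unfold a; ring).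
    replace (1 - Cmod v ^ 2) with (b * (2 - b)) by (unfold b; ring).
    assert (0 < a * b) by (apply Rmult_lt_0_compat; lra).
    replace (a * (2 - a) * (b * (2 - b))) with (a * b * ((2 - a) * (2 - b))) by ring.
    replace (4 * a * b) with (a * b * 4) by ring.
    apply Rmult_le_compat_l; [lra|]. nra. }
  assert (Hka : k * a <= 4 * b).
  { apply Rmult_le_reg_r with a; [lra|]. apply Rle_trans with (k * N ^ 2); [|lra].
    rewrite Rmult_assoc. apply Rmult_le_compat_l; [lra|]. nra. }
  assert (HkN : k * N <= 4 * b).
  { apply Rsqr_incr_0_var; [|lra]. unfold Rsqr.
    apply Rle_trans with (k * (4 * a * b)).
    - replace (k * N * (k * N)) with (k * (k * N ^ 2)) by ring.
      apply Rmult_le_compat_l; [lra | exact X2].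
    - replace (k * (4 * a * b)) with (k * a * (4 * b)) by ring.
      apply Rmult_le_compat_r; lra. }
  assert (HvuN : Cmod (v - u)%C <= N) by (rewrite <- E; nra).
  apply Rmult_lt_reg_l with k; [exact Hk|].
  replace (k * (4 * (M + 1) / k * b)) with (4 * b + M * (4 * b)) by (field; lra).
  apply Rle_lt_trans with (k * N + k * Cmod (u - tau)%C); [nra|].
  assert (k * Cmod (u - tau)%C < k * (M * a)) by (apply Rmult_lt_compat_l; lra).
  assert (M * (k * a) <= M * (4 * b)) by (apply Rmult_le_compat_l; lra).
  lra.
Qed.

Lemma locally_C_Cmod (z : C) (P : C -> Prop) :
  locally z P <-> exists d, 0 < d /\ forall w, Cmod (w - z)%C < d -> P w.
Proof.
  split.
  - intros H. apply C_near_elim, locally_C, H.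
  - intros (d & Hd & H). apply locally_C. exact (C_near_intro z P d Hd H).
Qed.

Lemma filterlim_C_Cmod {T : Type} (F : (T -> Prop) -> Prop) {FF : Filter F} (g : T -> C) (l : C) :
  filterlim g F (locally l) <-> forall e, 0 < e -> F (fun x => Cmod (g x - l)%C < e).
Proof.
  split.
  - intros H e He. apply (H (fun w => Cmod (w - l)%C < e)).
    apply locally_C_Cmod. exists e. auto.
  - intros H P HP. apply locally_C_Cmod in HP. destruct HP as (d & Hd & HP).
    unfold filtermap. apply filter_imp with (2 := H d Hd). auto.
Qed.

Lemma derivable_along_segment (g : C -> C) (k u v l : C) (t : R) :
  linear_approx g (v + RtoC t * (u - v))%C l ->
  derivable_pt_lim (fun s => Re (k * g (v + RtoC s * (u - v)))%C) t (Re (k * (l * (u - v)))%C).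
Proof.
  intros Hl e He.
  assert (Pk := Cmod_ge_0 k). assert (Puv := Cmod_ge_0 (u - v)%C).
  set (K := Cmod k * Cmod (u - v)%C + 1).
  assert (PK : 0 <= Cmod k * Cmod (u - v)%C) by (apply Rmult_le_pos; assumption).
  assert (HK : 0 < K) by (unfold K; lra).
  destruct (Hl (e / K)) as (d & Hd & Hl'); [apply Rdiv_lt_0_compat; assumption|].
  assert (Hd' : 0 < d / (Cmod (u - v)%C + 1)) by (apply Rdiv_lt_0_compat; lra).
  exists (mkposreal _ Hd'). cbn [pos]. intros s Hs Hsd.
  set (z := (v + RtoC t * (u - v))%C) in *.
  assert (Ez : (v + RtoC (t + s) * (u - v))%C = (z + RtoC s * (u - v))%C)
    by (unfold z; rewrite RtoC_plus; ring).
  rewrite Ez.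
  assert (Pa := Rabs_pos_lt s Hs).
  assert (Ew : Cmod (z + RtoC s * (u - v) - z)%C = Rabs s * Cmod (u - v)%C).
  { replace (z + RtoC s * (u - v) - z)%C with (RtoC s * (u - v))%C by ring.
    rewrite Cmod_mult, Cmod_R. reflexivity. }
  assert (B : Cmod (z + RtoC s * (u - v) - z)%C < d).
  { rewrite Ew. apply Rle_lt_trans with (Rabs s * (Cmod (u - v)%C + 1)).
    - apply Rmult_le_compat_l; lra.
    - replace d with (d / (Cmod (u - v)%C + 1) * (Cmod (u - v)%C + 1)) by (field; lra).
      apply Rmult_lt_compat_r; lra. }
  apply Hl' in B. rewrite Ew in B.
  set (err := (g (z + RtoC s * (u - v)) - g z - l * (z + RtoC s * (u - v) - z))%C) in *.
  replace ((Re (k * g (z + RtoC s * (u - v)))%C - Re (k * g z)%C) / s - Re (k * (l * (u - v)))%C)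
    with (Re (k * err)%C / s).
  - unfold Rdiv. rewrite Rabs_mult, Rabs_inv.
    apply Rmult_lt_reg_r with (Rabs s); [exact Pa|].
    rewrite Rmult_assoc, Rinv_l, Rmult_1_r by lra.
    eapply Rle_lt_trans; [apply re_le_Cmod|]. rewrite Cmod_mult.
    apply Rle_lt_trans with (Cmod k * (e / K * (Rabs s * Cmod (u - v)%C))).
    + apply Rmult_le_compat_l; assumption.
    + replace (Cmod k * (e / K * (Rabs s * Cmod (u - v)%C)))
        with (e * Rabs s * (Cmod k * Cmod (u - v)%C / K)) by (field; lra).
      rewrite <- (Rmult_1_r (e * Rabs s)) at 2.
      apply Rmult_lt_compat_l; [apply Rmult_lt_0_compat; assumption|].
      apply Rmult_lt_reg_r with K; [exact HK|].
      unfold Rdiv. rewrite Rmult_assoc, Rinv_l by lra. unfold K. lra.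
  - unfold err.
    replace (k * (g (z + RtoC s * (u - v)) - g z - l * (z + RtoC s * (u - v) - z)))%C
      with (k * g (z + RtoC s * (u - v)) - k * g z - RtoC s * (k * (l * (u - v))))%C by ring.
    generalize (k * g (z + RtoC s * (u - v)))%C (k * g z)%C (k * (l * (u - v)))%C.
    intros p q w. unfold Re, Cminus, Cplus, Copp, Cmult, RtoC; simpl. field. exact Hs.
Qed.

(** The real mean value theorem for the component of [g] in the direction of [g u - g v]. *)
Lemma C_mean_value (g g' : C -> C) (u v : C) (e : R) :
  (forall t, 0 <= t <= 1 ->
     linear_approx g (v + RtoC t * (u - v))%C (g' (v + RtoC t * (u - v))%C)
     /\ Cmod (g' (v + RtoC t * (u - v))%C) <= e) ->
  Cmod (g u - g v)%C <= e * Cmod (u - v)%C.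
Proof.
  intros H.
  set (h := (g u - g v)%C).
  destruct (MVT_gen (fun t => Re (Cconj h * g (v + RtoC t * (u - v)))%C) 0 1
     (fun t => Re (Cconj h * (g' (v + RtoC t * (u - v)) * (u - v)))%C)) as (c & Hc & Ec).
  - rewrite Rmin_left, Rmax_right by lra.
    intros t Ht. apply is_derive_Reals, derivable_along_segment. apply H. lra.
  - rewrite Rmin_left, Rmax_right by lra.
    intros t Ht. apply derivable_continuous_pt.
    eexists. apply derivable_along_segment. apply H. exact Ht.
  - rewrite Rmin_left, Rmax_right in Hc by lra.
    destruct (H c Hc) as [_ Hb].
    replace (v + RtoC 1 * (u - v))%C with u in Ec by ring.
    replace (v + RtoC 0 * (u - v))%C with v in Ec by ring.
    assert (E : Re (Cconj h * g u)%C - Re (Cconj h * g v)%C = Cmod h ^ 2).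
    { rewrite Cmod2_alt. unfold h. destruct (g u) as [u1 u2], (g v) as [v1 v2].
      unfold Re, Im, Cconj, Cminus, Cplus, Copp, Cmult; simpl. ring. }
    rewrite E, Rminus_0_r, Rmult_1_r in Ec.
    assert (B : Cmod h ^ 2 <= Cmod h * (e * Cmod (u - v)%C)).
    { rewrite Ec. eapply Rle_trans; [apply Rle_abs|].
      eapply Rle_trans; [apply re_le_Cmod|].
      rewrite !Cmod_mult, Cmod_conj. apply Rmult_le_compat_l; [apply Cmod_ge_0|].
      apply Rmult_le_compat_r; [apply Cmod_ge_0 | exact Hb]. }
    destruct (Cmod_ge_0 h) as [G | G].
    + apply Rmult_le_reg_l with (Cmod h); [exact G|]. lra.
    + rewrite <- G. apply Rmult_le_pos; [|apply Cmod_ge_0].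
      eapply Rle_trans; [apply Cmod_ge_0 | exact Hb].
Qed.

Lemma Cmod_segment (u v c : C) (t : R) :
  0 <= t <= 1 ->
  Cmod (v + RtoC t * (u - v) - c)%C <= t * Cmod (u - c)%C + (1 - t) * Cmod (v - c)%C.
Proof.
  intros Ht.
  replace (v + RtoC t * (u - v) - c)%C with (RtoC t * (u - c) + RtoC (1 - t) * (v - c))%C
    by (rewrite RtoC_minus; ring).
  eapply Rle_trans; [apply Cmod_triangle|].
  rewrite !Cmod_mult, !Cmod_R, !Rabs_pos_eq by lra. lra.
Qed.

Lemma convex_combination_lt (a b c t : R) :
  a < c -> b < c -> 0 <= t <= 1 -> t * a + (1 - t) * b < c.
Proof.
  intros Ha Hb Ht.
  apply Rle_lt_trans with (Rmax a b); [|apply Rmax_lub_lt; assumption].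
  assert (Ma := Rmax_l a b). assert (Mb := Rmax_r a b). nra.
Qed.

(** Writing the condition as [Cmod (z - tau) + M * Cmod z < M] exhibits the region as a
    sublevel set of a convex function. *)
Lemma stolz_region_convex (tau u v : C) (M t : R) :
  0 < M -> stolz_region tau M u -> stolz_region tau M v -> 0 <= t <= 1 ->
  stolz_region tau M (v + RtoC t * (u - v))%C.
Proof.
  unfold stolz_region, unit_disc. intros HM [Hu Su] [Hv Sv] Ht.
  assert (B := Cmod_segment u v tau t Ht).
  assert (B0 := Cmod_segment u v (RtoC 0) t Ht).
  rewrite !(fun z : C => ltac:(ring) : (z - RtoC 0 = z)%C) in B0.
  set (z := (v + RtoC t * (u - v))%C) in *.
  split.
  - eapply Rle_lt_trans; [exact B0 | apply convex_combination_lt; assumption].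
  - assert (B1 := Rmult_le_compat_l M _ _ (Rlt_le _ _ HM) B0).
    assert (B2 := convex_combination_lt (Cmod (u - tau)%C + M * Cmod u)
                    (Cmod (v - tau)%C + M * Cmod v) M t ltac:(lra) ltac:(lra) Ht).
    lra.
Qed.

(** The displacement [f w - w] has derivative [f' - 1], which is small in a Stolz region near
    [tau]; the mean value inequality applies on segments because the region is convex. *)
Lemma displacement_variation (f : C -> C) (tau : C) (M e : R) :
  holomorphic_self_map f -> nontangential_limit (C_derive f) tau (RtoC 1) ->
  1 < M -> 0 < e ->
  exists d, 0 < d /\ forall u v,
    stolz_region tau M u -> stolz_region tau M v ->
    Cmod (u - tau)%C < d -> Cmod (v - tau)%C < d ->
    Cmod ((f u - u) - (f v - v))%C <= e * Cmod (u - v)%C.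
Proof.
  intros Hf Hlim HM He.
  assert (H := proj1 (filterlim_C_Cmod _ _ _) (Hlim M HM) e He).
  apply locally_C_Cmod in H. destruct H as (d & Hd & H).
  exists d. split; [exact Hd|]. intros u v Su Sv Du Dv.
  apply (C_mean_value (fun w => f w - w)%C (fun w => C_derive f w - 1)%C).
  intros t Ht.
  assert (Sz := stolz_region_convex tau u v M t ltac:(lra) Su Sv Ht).
  assert (Dz := Cmod_segment u v tau t Ht).
  set (z := (v + RtoC t * (u - v))%C) in *.
  split.
  - destruct (Hf z (proj1 Sz)) as [_ Hz].
    apply (C_derive_correct f z z), is_derive_linear_approx in Hz.
    intros e' He'. destruct (Hz e' He') as (d' & Hd' & Hz').
    exists d'. split; [exact Hd'|]. intros w Hw.
    replace (f w - w - (f z - z) - (C_derive f z - 1) * (w - z))%C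
      with (f w - f z - C_derive f z * (w - z))%C by ring.
    apply Hz', Hw.
  - left. apply H; [|exact Sz].
    eapply Rle_lt_trans; [exact Dz | apply convex_combination_lt; assumption].
Qed.

(** If the orbit returns to a Stolz region infinitely often, its displacement tends to 0
    along these returns, because the orbit converges to [tau]. Comparing one return with
    later ones by [displacement_variation] bounds the displacement at a return by a small
    multiple of its distance to [tau], hence of its distance to the unit circle, and such a
    displacement is short for the hyperbolic metric. *)
Lemma recurrent_stolz_small_steps (f : C -> C) (tau z : C) (M : R) :
  holomorphic_self_map f -> nontangential_limit (C_derive f) tau (RtoC 1) ->
  Cmod tau = 1 -> unit_disc z -> 1 < M ->
  (forall e, 0 < e -> exists N, forall n, (N <= n)%nat -> Cmod (iterate f n z - tau)%C < e) ->
  (forall N, exists n, (N <= n)%nat /\ stolz_region tau M (iterate f n z)) ->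
  forall e, 0 < e -> exists n, step f z n <= e.
Proof.
  intros Hf Hlim Htau Hz HM Hconv Hrec e He.
  assert (Hk : 0 < e / (2 * M)) by (apply Rdiv_lt_0_compat; lra).
  set (k := e / (2 * M)) in *.
  destruct (displacement_variation f tau M k Hf Hlim HM Hk) as (d & Hd & Hvar).
  destruct (Hconv d Hd) as [N1 HN1].
  destruct (Hrec N1) as (n & Hn & Sn). exists n.
  assert (Hdisc := iterate_unit_disc f n z Hf Hz).
  assert (Hdisc' : unit_disc (f (iterate f n z))) by exact (proj1 (Hf _ Hdisc)).
  set (zn := iterate f n z) in *.
  assert (Dn : Cmod (zn - tau)%C < d) by (apply HN1; exact Hn).
  assert (Pos : 0 < Cmod (zn - tau)%C).
  { apply Cmod_gt_0, Cminus_neq_0. intros E. unfold unit_disc in Hdisc.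
    rewrite E in Hdisc. lra. }
  assert (Key : Cmod (f zn - zn)%C <= 2 * k * Cmod (zn - tau)%C).
  (* [s] is chosen so that [(k + 2) * s], the total error made at the later return,
     equals the main term. *)
  { set (s := k * Cmod (zn - tau)%C / (k + 2)).
    assert (Hs : 0 < s).
    { unfold s. apply Rdiv_lt_0_compat; [apply Rmult_lt_0_compat|]; lra. }
    destruct (Hconv s Hs) as [N2 HN2].
    destruct (Hrec (N1 + N2)%nat) as (m & Hm & Sm).
    assert (B := Hvar _ _ Sn Sm Dn (HN1 m ltac:(lia))).
    assert (B1 := HN2 m ltac:(lia)). assert (B2 := HN2 (S m) ltac:(lia)).
    change (iterate f (S m) z) with (f (iterate f m z)) in B2.
    set (zm := iterate f m z) in *.
    assert (T1 : Cmod (f zn - zn)%C <= Cmod (f zn - zn - (f zm - zm))%C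
                   + (Cmod (f zm - tau)%C + Cmod (zm - tau)%C)).
    { replace (f zn - zn)%C with ((f zn - zn - (f zm - zm)) + ((f zm - tau) - (zm - tau)))%C at 1 by ring.
      eapply Rle_trans; [apply Cmod_triangle|]. apply Rplus_le_compat_l.
      unfold Cminus at 1. eapply Rle_trans; [apply Cmod_triangle|]. rewrite Cmod_opp. lra. }
    assert (T2 : Cmod (zn - zm)%C <= Cmod (zn - tau)%C + Cmod (zm - tau)%C).
    { replace (zn - zm)%C with ((zn - tau) + - (zm - tau))%C by ring.
      eapply Rle_trans; [apply Cmod_triangle|]. rewrite Cmod_opp. lra. }
    assert (Es : (k + 2) * s = k * Cmod (zn - tau)%C) by (unfold s; field; lra).
    nra. }
  assert (E := pseudo_dist_mult zn (f zn) Hdisc Hdisc').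
  assert (L := moebius_denominator_lower zn (f zn) Hdisc').
  assert (Sn2 := proj2 Sn).
  unfold step. fold zn. change (iterate f (S n) z) with (f zn).
  assert (N : 0 < Cmod (1 - Cconj zn * f zn)%C) by (unfold unit_disc in Hdisc; lra).
  apply Rmult_le_reg_r with (Cmod (1 - Cconj zn * f zn)%C); [exact N|].
  rewrite E. eapply Rle_trans; [exact Key|].
  assert (Ek : 2 * k * M = e) by (unfold k; field; lra).
  rewrite <- Ek, (Rmult_assoc (2 * k) M).
  apply Rmult_le_compat_l; [lra|]. nra.
Qed.

(** * Sides of the radius at a boundary point *)

(** Coordinates of [u - tau] in the orthonormal frame [tau], [Ci * tau]. *)
Definition radial_part (tau u : C) : R := Re ((u - tau) * Cconj tau)%C.
Definition tangential_part (tau u : C) : R := Im ((u - tau) * Cconj tau)%C.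

Lemma parts_decomposition (tau u : C) :
  Cmod tau = 1 ->
  u = ((1 + (radial_part tau u, tangential_part tau u)) * tau)%C.
Proof.
  intros Htau. assert (E := Cmod2_conj tau). rewrite Htau in E.
  replace ((radial_part tau u, tangential_part tau u) : C) with ((u - tau) * Cconj tau)%C
    by (unfold radial_part, tangential_part; apply surjective_pairing).
  replace ((1 + (u - tau) * Cconj tau) * tau)%C with (tau + (u - tau) * (tau * Cconj tau))%C by ring.
  rewrite <- E, pow1. ring.
Qed.

Lemma parts_sqr (tau u : C) :
  Cmod tau = 1 ->
  radial_part tau u ^ 2 + tangential_part tau u ^ 2 = Cmod (u - tau)%C ^ 2.
Proof.
  intros Htau. unfold radial_part, tangential_part.
  rewrite <- Cmod2_alt, Cmod_mult, Cmod_conj, Htau. ring.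
Qed.

Lemma Cmod_sqr_parts (tau u : C) :
  Cmod tau = 1 -> Cmod u ^ 2 = 1 + 2 * radial_part tau u + Cmod (u - tau)%C ^ 2.
Proof.
  intros Htau. rewrite <- parts_sqr by exact Htau.
  rewrite (parts_decomposition tau u Htau) at 1.
  rewrite Cmod_mult, Htau, Rmult_1_r, Cmod2_alt.
  unfold Re, Im, Cplus, RtoC; simpl. ring.
Qed.

(** From [Cmod u ^ 2 = 1 + 2 * radial_part tau u + Cmod (u - tau) ^ 2], the radial part is
    controlled by [1 - Cmod u], which is at most [Cmod (u - tau) / M] outside the Stolz
    region. *)
Lemma radial_part_small (tau u : C) (M : R) :
  Cmod tau = 1 -> 0 < M -> unit_disc u -> ~ stolz_region tau M u ->
  Rabs (radial_part tau u) <= Cmod (u - tau)%C * (/ M + Cmod (u - tau)%C / 2).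
Proof.
  intros Htau HM Hu Hs.
  assert (E := Cmod_sqr_parts tau u Htau).
  assert (P := Cmod_ge_0 u). assert (Pt := Cmod_ge_0 (u - tau)%C).
  assert (S1 : M * (1 - Cmod u) <= Cmod (u - tau)%C).
  { apply Rnot_lt_le. intros H. apply Hs. split; assumption. }
  unfold unit_disc in Hu.
  assert (S2 : 1 - Cmod u <= Cmod (u - tau)%C * / M).
  { apply Rmult_le_reg_l with M; [exact HM|].
    replace (M * (Cmod (u - tau)%C * / M)) with (Cmod (u - tau)%C) by (field; lra). exact S1. }
  assert (radial_part tau u <= 0) by nra.
  rewrite Rabs_left1 by assumption. nra.
Qed.

Lemma tangential_part_large (tau u : C) :
  Cmod tau = 1 ->
  Cmod (u - tau)%C <= Rabs (radial_part tau u) + Rabs (tangential_part tau u).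
Proof.
  intros Htau. assert (E := parts_sqr tau u Htau).
  assert (P1 := Rabs_pos (radial_part tau u)). assert (P2 := Rabs_pos (tangential_part tau u)).
  apply Rsqr_incr_0_var; [|lra]. unfold Rsqr.
  rewrite <- (pow2_abs (radial_part tau u)), <- (pow2_abs (tangential_part tau u)) in E. nra.
Qed.

(** The bound [1 / 2] on the distance makes the tangential part dominate the radial part
    as soon as [4 <= M]. *)
Definition nearly_tangential (tau : C) (M : R) (u : C) : Prop :=
  unit_disc u /\ ~ stolz_region tau M u /\ Cmod (u - tau)%C < 1 / 2.

Lemma nearly_tangential_bounds (tau u : C) (M : R) :
  Cmod tau = 1 -> 4 <= M -> nearly_tangential tau M u ->
  0 < Cmod (u - tau)%C /\ Rabs (radial_part tau u) <= Cmod (u - tau)%C / 2 /\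
  Cmod (u - tau)%C / 2 <= Rabs (tangential_part tau u) /\
  1 - Cmod u <= Cmod (u - tau)%C / M.
Proof.
  intros Htau HM (Hu & Hs & Hn).
  assert (R1 := radial_part_small tau u M Htau ltac:(lra) Hu Hs).
  assert (L1 := tangential_part_large tau u Htau).
  assert (Hi : / M <= / 4) by (apply Rinv_le_contravar; lra).
  assert (P : 0 < Cmod (u - tau)%C).
  { apply Cmod_gt_0, Cminus_neq_0. intros E. unfold unit_disc in Hu. rewrite E in Hu. lra. }
  assert (R2 : Rabs (radial_part tau u) <= Cmod (u - tau)%C / 2).
  { eapply Rle_trans; [exact R1|]. unfold Rdiv at 2. apply Rmult_le_compat_l; lra. }
  repeat split; try lra.
  apply Rnot_lt_le. intros H. apply Hs. split; [exact Hu|].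
  apply Rmult_lt_reg_r with (/ M); [apply Rinv_0_lt_compat; lra|].
  replace (M * (1 - Cmod u) * / M) with (1 - Cmod u) by (field; lra). exact H.
Qed.

(** Points outside a large Stolz region on opposite sides of the radius are hyperbolically
    far apart: the tangential parts add up in [Im (1 - Cconj u * v)], which is therefore at
    least a quarter of the sum of the distances to [tau], while both points are much closer
    to the unit circle than to [tau]. *)
Lemma not_opposite_sides (tau u v : C) (M r : R) :
  Cmod tau = 1 -> 4 <= M -> 16 / M ^ 2 < 1 - r ^ 2 ->
  nearly_tangential tau M u -> nearly_tangential tau M v -> pseudo_dist u v <= r ->
  0 < tangential_part tau u -> ~ tangential_part tau v < 0.
Proof.
  intros Htau HM Hr Hu Hv Huv Bu Bv.
  destruct (nearly_tangential_bounds tau u M Htau HM Hu) as (Pu & Au & Tu & Su).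
  destruct (nearly_tangential_bounds tau v M Htau HM Hv) as (Pv & Av & Tv & Sv).
  destruct Hu as (Du & _ & Nu). destruct Hv as (Dv & _ & Nv).
  assert (X := pseudo_dist_cross u v r Du Dv Huv).
  assert (Cu := Cmod_ge_0 u). assert (Cv := Cmod_ge_0 v). unfold unit_disc in Du, Dv.
  set (t := Cmod (u - tau)%C) in *. set (s := Cmod (v - tau)%C) in *.
  rewrite (Rabs_pos_eq (tangential_part tau u)) in Tu by lra.
  rewrite (Rabs_left (tangential_part tau v)) in Tv by lra.
  assert (HN : (t + s) / 4 <= Cmod (1 - Cconj u * v)%C).
  { eapply Rle_trans; [|apply im_le_Cmod].
    assert (E : Im (1 - Cconj u * v)%C =
      (1 + radial_part tau v) * tangential_part tau u
      - (1 + radial_part tau u) * tangential_part tau v).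
    { rewrite (parts_decomposition tau u Htau) at 1.
      rewrite (parts_decomposition tau v Htau) at 1.
      generalize (radial_part tau u) (tangential_part tau u)
        (radial_part tau v) (tangential_part tau v). intros a b a' b'.
      assert (E1 := Cmod2_alt tau). rewrite Htau in E1.
      destruct tau as [x y]. unfold Re, Im in E1. simpl in E1.
      unfold Im, Cconj, Cminus, Cmult, Cplus, Copp, RtoC; simpl.
      replace ((1 + a') * b - (1 + a) * b')
        with (((1 + a') * b - (1 + a) * b') * (x * (x * 1) + y * (y * 1))).
      - ring.
      - rewrite <- E1. ring. }
    rewrite E. apply Rabs_le_between in Au. apply Rabs_le_between in Av.
    eapply Rle_trans; [|apply Rle_abs]. nra. }
  assert (HM2 : 0 < M ^ 2) by nra.
  assert (Hr' : 16 < (1 - r ^ 2) * M ^ 2).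
  { apply Rmult_lt_reg_r with (/ M ^ 2); [apply Rinv_0_lt_compat; exact HM2|].
    rewrite Rmult_assoc, Rinv_r by lra. lra. }
  assert (Su' : M * (1 - Cmod u) <= t).
  { replace t with (M * (t / M)) by (field; lra). apply Rmult_le_compat_l; lra. }
  assert (Sv' : M * (1 - Cmod v) <= s).
  { replace s with (M * (s / M)) by (field; lra). apply Rmult_le_compat_l; lra. }
  assert (X1 : M ^ 2 * ((1 - Cmod u ^ 2) * (1 - Cmod v ^ 2)) <= (2 * t) * (2 * s)).
  { replace (M ^ 2 * ((1 - Cmod u ^ 2) * (1 - Cmod v ^ 2)))
      with ((M * (1 - Cmod u) * (1 + Cmod u)) * (M * (1 - Cmod v) * (1 + Cmod v))) by ring.
    assert (0 <= M * (1 - Cmod u)) by (apply Rmult_le_pos; lra).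
    assert (0 <= M * (1 - Cmod v)) by (apply Rmult_le_pos; lra).
    apply Rmult_le_compat; nra. }
  assert (X2 : ((t + s) / 4) ^ 2 <= Cmod (1 - Cconj u * v)%C ^ 2) by (apply pow_incr; lra).
  assert (X3 : (1 - r ^ 2) * M ^ 2 * ((t + s) / 4) ^ 2 <= 4 * t * s).
  { apply Rle_trans with (M ^ 2 * ((1 - r ^ 2) * Cmod (1 - Cconj u * v)%C ^ 2)).
    - replace (M ^ 2 * ((1 - r ^ 2) * Cmod (1 - Cconj u * v)%C ^ 2))
        with ((1 - r ^ 2) * M ^ 2 * Cmod (1 - Cconj u * v)%C ^ 2) by ring.
      apply Rmult_le_compat_l; lra.
    - apply Rle_trans with (M ^ 2 * ((1 - Cmod u ^ 2) * (1 - Cmod v ^ 2))); [|lra].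
      apply Rmult_le_compat_l; lra. }
  assert (X4 : 16 * ((t + s) / 4) ^ 2 < (1 - r ^ 2) * M ^ 2 * ((t + s) / 4) ^ 2).
  { apply Rmult_lt_compat_r; [apply pow_lt; lra | exact Hr']. }
  assert (X5 := pow2_ge_0 (t - s)). lra.
Qed.

Lemma same_side (tau u v : C) (M r eps : R) :
  (eps = 1 \/ eps = -1) ->
  Cmod tau = 1 -> 4 <= M -> 16 / M ^ 2 < 1 - r ^ 2 ->
  nearly_tangential tau M u -> nearly_tangential tau M v -> pseudo_dist u v <= r ->
  0 < eps * tangential_part tau u -> 0 < eps * tangential_part tau v.
Proof.
  intros Heps Htau HM Hr Hu Hv Huv Bu.
  destruct (nearly_tangential_bounds tau v M Htau HM Hv) as (Pv & _ & Tv & _).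
  destruct (Rtotal_order (tangential_part tau v) 0) as [H | [H | H]].
  - destruct Heps as [-> | ->]; [|lra]. exfalso.
    apply (not_opposite_sides tau u v M r); auto. lra.
  - rewrite H, Rabs_R0 in Tv. lra.
  - destruct Heps as [-> | ->]; [lra|]. exfalso.
    apply (not_opposite_sides tau v u M r); auto; [|lra].
    rewrite pseudo_dist_sym. exact Huv.
Qed.

Lemma aperture_exists (r : R) : 0 <= r < 1 -> exists M, 4 <= M /\ 16 / M ^ 2 < 1 - r ^ 2.
Proof.
  intros Hr. assert (Hk : 0 < 1 - r ^ 2 <= 1) by nra.
  set (k := 1 - r ^ 2) in *.
  assert (Hi : 1 <= / k) by (rewrite <- Rinv_1; apply Rinv_le_contravar; lra).
  exists (8 * / k). split; [lra|].
  replace (16 / (8 * / k) ^ 2) with (k * k / 4) by (field; lra). nra.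
Qed.

(** In the frame [tau], [Ci * tau] the unit vector is [(A / t, B / t)]; its tangential
    coordinate differs from [eps] by at most [Rabs A / t], since [t <= Rabs A + Rabs B]. *)
Lemma direction_estimate (tau u : C) (M eps : R) :
  Cmod tau = 1 -> 0 < M -> unit_disc u -> ~ stolz_region tau M u ->
  (eps = 1 \/ eps = -1) -> 0 < eps * tangential_part tau u ->
  Cmod ((u - tau) / RtoC (Cmod (u - tau)) - RtoC eps * Ci * tau)%C
    <= 2 * / M + Cmod (u - tau)%C.
Proof.
  intros Htau HM Hu Hs Heps Hside.
  assert (R1 := radial_part_small tau u M Htau HM Hu Hs).
  assert (L1 := tangential_part_large tau u Htau).
  assert (E := parts_sqr tau u Htau).
  assert (P : 0 < Cmod (u - tau)%C).
  { apply Cmod_gt_0, Cminus_neq_0. intros E'. unfold unit_disc in Hu. rewrite E' in Hu. lra. }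
  assert (D : (u - tau)%C = ((radial_part tau u, tangential_part tau u) * tau)%C).
  { rewrite (parts_decomposition tau u Htau) at 1. ring. }
  assert (Habs : Rabs (tangential_part tau u) = eps * tangential_part tau u).
  { destruct Heps as [-> | ->]; [rewrite Rabs_pos_eq | rewrite Rabs_left]; lra. }
  rewrite D at 1.
  set (t := Cmod (u - tau)%C) in *.
  set (A := radial_part tau u) in *. set (B := tangential_part tau u) in *.
  assert (Heps2 : eps * eps = 1) by (destruct Heps as [-> | ->]; ring).
  assert (HBt : Rabs B <= t) by (apply Rsqr_incr_0_var; [|lra]; unfold Rsqr; rewrite <- (pow2_abs B) in E; nra).
  replace ((A, B) * tau / RtoC t - RtoC eps * Ci * tau)%C
    with ((RtoC (A / t) + Ci * RtoC (eps * (Rabs B / t - 1))) * tau)%C.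
  - rewrite Cmod_mult, Htau, Rmult_1_r.
    eapply Rle_trans; [apply Cmod_triangle|].
    rewrite Cmod_mult, Cmod_Ci, !Cmod_R, Rmult_1_l.
    assert (E1 : Rabs (A / t) <= / M + t / 2).
    { unfold Rdiv at 1. rewrite Rabs_mult, Rabs_inv, (Rabs_pos_eq t) by lra.
      apply Rmult_le_reg_r with t; [exact P|].
      rewrite Rmult_assoc, Rinv_l by lra. lra. }
    assert (E2 : Rabs (eps * (Rabs B / t - 1)) <= Rabs (A / t)).
    { rewrite Rabs_mult. replace (Rabs eps) with 1
        by (destruct Heps as [-> | ->]; [rewrite Rabs_pos_eq | rewrite Rabs_left]; lra).
      unfold Rdiv at 2. rewrite Rabs_mult, Rabs_inv, (Rabs_pos_eq t) by lra.
      replace (Rabs B / t - 1) with (- ((t - Rabs B) * / t)) by (field; lra).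
      rewrite Rmult_1_l, Rabs_Ropp, Rabs_mult, Rabs_inv, (Rabs_pos_eq t) by lra.
      apply Rmult_le_compat_r; [left; apply Rinv_0_lt_compat; exact P|].
      rewrite Rabs_pos_eq; lra. }
    lra.
  - replace (eps * (Rabs B / t - 1)) with (B / t - eps).
    + assert (Nt : RtoC t <> RtoC 0) by (intros Q; apply RtoC_inj in Q; lra).
      rewrite RtoC_minus, !RtoC_div by lra.
      replace ((A, B) : C) with (RtoC A + Ci * RtoC B)%C.
      * field. exact Nt.
      * unfold Cplus, Cmult, Ci, RtoC; simpl. f_equal; ring.
    + rewrite Habs. replace (eps * (eps * B / t - 1)) with ((eps * eps) * (B / t) - eps) by (unfold Rdiv; ring).
      rewrite Heps2. ring.
Qed.

(** * Tangential convergence of the orbits *)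

Lemma wolff_point_orbit (f : C -> C) (tau z : C) :
  wolff_point f tau -> unit_disc z ->
  forall e, 0 < e -> exists N, forall n, (N <= n)%nat -> Cmod (iterate f n z - tau)%C < e.
Proof.
  intros [_ H] Hz e He.
  destruct (H (fun w => w = z)) with (eps := e) as [N HN]; auto.
  - intros I U _ HU. destruct (HU z eq_refl) as [i Hi].
    exists (i :: nil). intros w ->. exists i. split; [left; reflexivity | exact Hi].
  - intros w ->. exact Hz.
  - exists N. intros n Hn. apply HN; auto.
Qed.

Lemma wolff_point_unique (f : C -> C) (tau tau' : C) :
  wolff_point f tau -> wolff_point f tau' -> tau = tau'.
Proof.
  intros H H'. destruct (Ceq_dec tau tau') as [E | N]; [exact E|]. exfalso.
  apply Cminus_neq_0, Cmod_gt_0 in N.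
  assert (H0 : unit_disc (RtoC 0)) by (unfold unit_disc; rewrite Cmod_0; lra).
  destruct (wolff_point_orbit f tau _ H H0 (Cmod (tau - tau')%C / 2) ltac:(lra)) as [n1 H1].
  destruct (wolff_point_orbit f tau' _ H' H0 (Cmod (tau - tau')%C / 2) ltac:(lra)) as [n2 H2].
  specialize (H1 (n1 + n2)%nat ltac:(lia)). specialize (H2 (n1 + n2)%nat ltac:(lia)).
  set (w := iterate f (n1 + n2) (RtoC 0)) in *.
  assert (T := Cmod_triangle (tau - w)%C (w - tau')%C).
  replace (tau - w + (w - tau'))%C with (tau - tau')%C in T by ring.
  rewrite (Cmod_minus_sym tau w) in T. lra.
Qed.

(** The orbit of a point [z0] with positive step cannot return infinitely often to a Stolz
    region, by [recurrent_stolz_small_steps]. Any other orbit stays at bounded hyperbolic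
    distance from it, so its returns would put the orbit of [z0] in a larger region. *)
Lemma orbit_leaves_stolz_regions (f : C -> C) (tau : C) :
  holomorphic_self_map f -> parabolic f -> wolff_point f tau -> positive_hyperbolic_step f ->
  forall z M, unit_disc z -> 1 < M ->
  exists N, forall n, (N <= n)%nat -> ~ stolz_region tau M (iterate f n z).
Proof.
  intros Hf [_ (tau' & Htau' & Hlim)] Htau (z0 & Hz0 & Hpos) z M Hz HM.
  rewrite (wolff_point_unique f tau' tau Htau' Htau) in Hlim.
  destruct (hyperbolic_step_pos f z0 Hf Hz0 Hpos) as (d & Hd & Hstep).
  apply NNPP. intros Hno.
  set (r := pseudo_dist z z0).
  assert (Hr : 0 <= r < 1) by (split; [apply pseudo_dist_ge_0 | apply pseudo_dist_lt_1; assumption]).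
  assert (HM' : 1 < 4 * (M + 1) / (1 - r ^ 2)).
  { apply Rmult_lt_reg_r with (1 - r ^ 2); [nra|].
    unfold Rdiv. rewrite Rmult_assoc, Rinv_l by nra. nra. }
  destruct (recurrent_stolz_small_steps f tau z0 _ Hf Hlim (proj1 Htau) Hz0 HM'
              (wolff_point_orbit f tau z0 Htau Hz0)) with (e := d / 2) as [n Hn].
  - intros N. apply NNPP. intros H. apply Hno. exists N. intros n Hn Sn. apply H.
    exists n. split; [exact Hn|].
    apply (stolz_region_pseudo_dist tau (iterate f n z) (iterate f n z0) M r); try lra.
    + apply iterate_unit_disc; assumption.
    + apply pseudo_dist_iterate; assumption.
    + exact Sn.
  - lra.
  - specialize (Hstep n). lra.
Qed.

Theorem corollary12 (f : C -> C) (tau : C)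
    (hf : holomorphic_self_map f)
    (hpar : parabolic f)
    (htau : wolff_point f tau)
    (hstep : positive_hyperbolic_step f) :
  (forall z : C, unit_disc z ->
     converges_tangentially (fun n : nat => iterate f n z) tau) /\
  exists eps : R, (eps = 1 \/ eps = -1) /\
    forall z : C, unit_disc z ->
      filterlim
        (fun n : nat =>
           ((iterate f n z - tau) / RtoC (Cmod (iterate f n z - tau)))%C)
        eventually
        (locally (RtoC eps * Ci * tau)%C).
Proof.
  assert (Hout := orbit_leaves_stolz_regions f tau hf hpar htau hstep).
  assert (Hconv := fun z => wolff_point_orbit f tau z htau).
  assert (Ht1 := proj1 htau).
  assert (Htan : forall z M, unit_disc z -> 4 <= M ->
    exists N, forall n, (N <= n)%nat -> nearly_tangential tau M (iterate f n z)).
  { intros z M Hz HM.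
    destruct (Hout z M Hz ltac:(lra)) as [N1 H1].
    destruct (Hconv z Hz (1 / 2) ltac:(lra)) as [N2 H2].
    exists (N1 + N2)%nat. intros n Hn. split; [|split].
    - apply iterate_unit_disc; assumption.
    - apply H1. lia.
    - apply H2. lia. }
  split.
  { intros z Hz. split.
    - apply (filterlim_C_Cmod eventually). exact (Hconv z Hz).
    - intros M HM. exact (Hout z M Hz HM). }
  assert (H0 : unit_disc (RtoC 0)) by (unfold unit_disc; rewrite Cmod_0; lra).
  (* Consecutive points of one orbit lie at bounded hyperbolic distance, so the orbit cannot
     change side once it is nearly tangential; the sign of this orbit serves for all others. *)
  assert (Hside0 : exists eps, (eps = 1 \/ eps = -1) /\ exists N, forall n, (N <= n)%nat ->
     0 < eps * tangential_part tau (iterate f n (RtoC 0))).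
  { set (r := pseudo_dist (RtoC 0) (f (RtoC 0))).
    assert (Hf0 := proj1 (hf _ H0)).
    destruct (aperture_exists r) as (M & HM & HMr).
    { split; [apply pseudo_dist_ge_0 | apply pseudo_dist_lt_1; assumption]. }
    destruct (Htan (RtoC 0) M H0 HM) as [N HN].
    assert (Hstart : exists eps, (eps = 1 \/ eps = -1) /\
              0 < eps * tangential_part tau (iterate f N (RtoC 0))).
    { destruct (nearly_tangential_bounds tau _ M Ht1 HM (HN N (le_n N))) as (P & _ & T & _).
      destruct (Rtotal_order (tangential_part tau (iterate f N (RtoC 0))) 0) as [H | [H | H]].
      - exists (-1). split; [right; reflexivity | lra].
      - rewrite H, Rabs_R0 in T. lra.
      - exists 1. split; [left; reflexivity | lra]. }
    destruct Hstart as (eps & Heps & HepsN). exists eps. split; [exact Heps|].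
    exists N. intros n Hn. induction Hn as [|n Hn IH]; [exact HepsN|].
    apply (same_side tau (iterate f n (RtoC 0)) _ M r); auto.
    exact (step_decreasing f (RtoC 0) 0 n hf H0 (Nat.le_0_l n)). }
  destruct Hside0 as (eps & Heps & N0 & HN0).
  exists eps. split; [exact Heps|]. intros z Hz.
  assert (Hside : exists N, forall n, (N <= n)%nat ->
     0 < eps * tangential_part tau (iterate f n z)).
  { set (r := pseudo_dist (RtoC 0) z).
    destruct (aperture_exists r) as (M & HM & HMr).
    { split; [apply pseudo_dist_ge_0 | apply pseudo_dist_lt_1; assumption]. }
    destruct (Htan (RtoC 0) M H0 HM) as [N1 H1].
    destruct (Htan z M Hz HM) as [N2 H2].
    exists (N0 + N1 + N2)%nat. intros n Hn.
    apply (same_side tau (iterate f n (RtoC 0)) _ M r); auto.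
    - apply H1. lia.
    - apply H2. lia.
    - apply pseudo_dist_iterate; assumption.
    - apply HN0. lia. }
  destruct Hside as [N3 HN3].
  apply (filterlim_C_Cmod eventually). intros e He.
  set (M := 1 + 4 / e).
  assert (He4 : 0 < 4 / e) by (apply Rdiv_lt_0_compat; lra).
  destruct (Hout z M Hz ltac:(unfold M; lra)) as [N1 H1].
  destruct (Hconv z Hz (e / 2) ltac:(lra)) as [N2 H2].
  exists (N1 + N2 + N3)%nat. intros n Hn.
  specialize (H2 n ltac:(lia)).
  eapply Rle_lt_trans.
  - apply (direction_estimate tau (iterate f n z) M eps); auto.
    + unfold M; lra.
    + apply iterate_unit_disc; assumption.
    + apply H1. lia.
    + apply HN3. lia.
  - assert (/ M < e / 4).
    { replace (e / 4) with (/ (4 / e)) by (field; lra).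
      apply Rinv_lt_contravar; [|unfold M; lra].
      apply Rmult_lt_0_compat; unfold M; lra. }
    lra.
Qed.
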